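(* Let $d\geq 2$ and $k\geq 2$ be integers. (a) Let $X=\{\mathbf{x}_1,\dots,\mathbf{x}_n\}$ be a point configuration in $\mathbb{R}^d$ whose points do not all coincide. Then $X$ is a $k$-antipodal point configuration in $\mathbb{R}^d$ if and only if there exists $\mathbf{K}_{\mathbf{o}}\in\mathcal{K}_{\mathbf{o}}^{d}$ such that $X$ is a $k$-diametral point configuration in $\mathbb{M}^d_{\mathbf{K}_{\mathbf{o}}}$. (b) Moreover, $$F_k(d)=\max_{\mathbf{K}_{\mathbf{o}}\in\mathcal{K}_{\mathbf{o}}^{d}} f_k(\mathbb{M}^d_{\mathbf{K}_{\mathbf{o}}})=(k-1)2^d .$$ (c) Furthermore, for $\mathbf{K}_{\mathbf{o}}\in\mathcal{K}_{\mathbf{o}}^{d}$ one has $f_k(\mathbb{M}^d_{\mathbf{K}_{\mathbf{o}}})=(k-1)2^d$ if and only if $\mathbf{K}_{\mathbf{o}}$ is an $\mathbf{o}$-symmetric affine $d$-cube of $\mathbb{R}^d$, in which case every $k$-diametral point configuration of $(k-1)2^d$ points in $\mathbb{M}^d_{\mathbf{K}_{\mathbf{o}}}$ is identical to the vertex set of an affine $d$-cube homothetic to $\mathbf{K}_{\mathbf{o}}$, with each vertex having multiplicity $k-1$.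
   Context: $\mathcal{K}_{\mathbf{o}}^{d}$ is the family of $\mathbf{o}$-symmetric convex bodies in $\mathbb{R}^d$ (compact convex sets with nonempty interior, symmetric about the origin $\mathbf{o}$). For $\mathbf{K}_{\mathbf{o}}\in\mathcal{K}_{\mathbf{o}}^{d}$ let $\|\mathbf{x}\|_{\mathbf{K}_{\mathbf{o}}}=\min\{\lambda\geq 0 : \mathbf{x}\in\lambda\mathbf{K}_{\mathbf{o}}\}$, and let $\mathbb{M}^d_{\mathbf{K}_{\mathbf{o}}}$ denote $\mathbb{R}^d$ equipped with this norm. A point configuration of $n\ge 1$ points in $\mathbb{R}^d$ is a labeled family $X=\{\mathbf{x}_1,\dots,\mathbf{x}_n\}\subset\mathbb{R}^d$ whose members need not be distinct (points are counted with multiplicity). Its diameter is $\mathrm{diam}(X)=\max_{i<j}\|\mathbf{x}_i-\mathbf{x}_j\|_{\mathbf{K}_{\mathbf{o}}}$. A point configuration $X$ of positive diameter in $\mathbb{M}^d_{\mathbf{K}_{\mathbf{o}}}$ is $k$-diametral if for any indices $1\leq n_1<\dots<n_k\leq n$ there are $i<j$ with $\|\mathbf{x}_{n_i}-\mathbf{x}_{n_j}\|_{\mathbf{K}_{\mathbf{o}}}=\mathrm{diam}(X)$. $f_k(\mathbb{M}^d_{\mathbf{K}_{\mathbf{o}}})$ is the largest $n$ for which there is a $k$-diametral point configuration of $n$ points in $\mathbb{M}^d_{\mathbf{K}_{\mathbf{o}}}$. A point configuration $X$ in $\mathbb{R}^d$ is $k$-antipodal if for any indices $1\leq n_1<\dots<n_k\leq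 n$ there are $i<j$ such that $\mathbf{x}_{n_i}$ and $\mathbf{x}_{n_j}$ lie on distinct parallel supporting hyperplanes of $\mathrm{conv}(X)$ (one point on each). $F_k(d)$ is the largest $n$ for which there is a $k$-antipodal point configuration of $n$ points in $\mathbb{R}^d$. An affine $d$-cube is the image of $[0,1]^d$ under an invertible affine map of $\mathbb{R}^d$. *)

(* Defs.v *)
(* R^d is 'rV[R]_d with its product topology, for an
   arbitrary R : realType. *)
From mathcomp Require Export all_boot all_order all_algebra.
From mathcomp Require Export all_classical all_reals all_analysis.
Export Order.TTheory GRing.Theory Num.Theory numFieldNormedType.Exports.

Set Implicit Arguments.
Unset Strict Implicit.
Unset Printing Implicit Defensive.

Local Open Scope classical_set_scope.
Local Open Scope ring_scope.

Definition is_max (A : set nat) (m : nat) : Prop := A m /\ ubound A m.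

Section Geometry.
Variables (R : realType) (d : nat).
Implicit Types (K S H Q : set 'rV[R]_d) (p q u v : 'rV[R]_d).

Definition o_symmetric_body K : Prop :=
  [/\ compact K, convex_set K, K° !=set0 & forall p, K p -> K (- p)].

(* For K an o-symmetric convex body the infimum is attained. *)
Definition normK K p : R :=
  inf [set l : R | 0 <= l /\ [set l *: q | q in K] p].

Definition conv_hull S : set 'rV[R]_d := smallest (@convex_set R 'rV[R]_d) S.

Definition hyperplane (u : 'cV[R]_d) (c : R) : set 'rV[R]_d :=
  [set p | (p *m u) 0 0 = c].

(* Either side of H is covered, as (u, c) and (- u, - c) define the same
   hyperplane. *)
Definition supporting_hyperplane S H : Prop :=
  exists (u : 'cV[R]_d) (c : R),
    [/\ u != 0, H = hyperplane u c, H `&` S !=set0 &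
        forall p, S p -> (p *m u) 0 0 <= c].

Definition parallel H1 H2 : Prop :=
  exists v, H2 = [set p + v | p in H1].

Definition unit_cube : set 'rV[R]_d :=
  [set p | forall i, 0 <= p 0 i <= 1].

Definition affine_cube Q : Prop :=
  exists (A : 'M[R]_d) (b : 'rV[R]_d),
    A \in unitmx /\ Q = [set p *m A + b | p in unit_cube].

Definition homothetic Q K : Prop :=
  exists (v : 'rV[R]_d) (l : R), 0 < l /\ Q = [set v + l *: p | p in K].

(* The vertices of a polytope are its extreme points. *)
Definition vertices Q : set 'rV[R]_d :=
  [set p | Q p /\ forall (a b : 'rV[R]_d) (t : R), Q a -> Q b ->
     0 < t < 1 -> p = (1 - t) *: a + t *: b -> a = p /\ b = p].

Section Configuration.
Variables (n : nat) (x : 'I_n -> 'rV[R]_d).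

Definition diam K : R :=
  \big[Num.max/0]_(ij : 'I_n * 'I_n | (ij.1 < ij.2)%N)
     normK K (x ij.1 - x ij.2).

(* s lists the indices n_1 < ... < n_k. *)
Definition k_diametral K (k : nat) : Prop :=
  0 < diam K /\
  forall s : 'I_k -> 'I_n, {homo s : i j / (i < j)%N} ->
    exists i j : 'I_k, (i < j)%N /\ normK K (x (s i) - x (s j)) = diam K.

Definition k_antipodal (k : nat) : Prop :=
  forall s : 'I_k -> 'I_n, {homo s : i j / (i < j)%N} ->
    exists i j : 'I_k, (i < j)%N /\
    exists H1 H2 : set 'rV[R]_d,
      [/\ supporting_hyperplane (conv_hull (range x)) H1,
          supporting_hyperplane (conv_hull (range x)) H2,
          parallel H1 H2, H1 <> H2 & H1 (x (s i)) /\ H2 (x (s j))].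

End Configuration.

(* "f_k of the normed space with unit ball K exists and equals m". *)
Definition fk_eq K (k m : nat) : Prop :=
  is_max [set n | (0 < n)%N /\ exists x : 'I_n -> 'rV[R]_d, k_diametral x K k]
    m.

End Geometry.

(* "F_k(d) exists and equals m". *)
Definition Fk_eq (R : realType) (d k m : nat) : Prop :=
  is_max [set n | (0 < n)%N /\ exists x : 'I_n -> 'rV[R]_d, k_antipodal x k] m.

(* Main.v *)
(* x_i and x_j lie on distinct parallel supporting hyperplanes of conv X iff some
   linear functional u satisfies u x_i <= u x_l <= u x_j for all l and
   u x_i < u x_j; for (a), the unit ball cut out by the slabs |u p| <= u x_j - u x_i
   over all antipodal pairs makes exactly those pairs diametral.

   For the bound, let P be the polytope of all such slabs.  The half-size tiles
   (P + x_i) / 2 lie in P, and since k of the indices contain an antipodal pair,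
   no point is interior to k of them; comparing volumes, n / 2^d <= k - 1.
   Volumes are replaced by numbers of grid points, iterating the subdivision so
   that boundary effects disappear.

   If n = (k - 1) 2^d, every point of P lies in at least k - 1 tiles.  At a vertex
   v of conv X only the tiles with x_i = v occur, so v has multiplicity k - 1, and
   then any two distinct vertices are antipodal and every point is a vertex.  Near
   the midpoint of an edge two tiles have to share the whole neighbourhood, which
   carries the edge directions of one endpoint over to the other.  Starting with
   an irredundant generating set of the cone at a vertex, this produces all the
   corners of a parallelotope, and conv X is that parallelotope.  In the diametral
   case its faces and diagonals determine the unit ball. *)
Require Import Defs.
From mathcomp Require Import ring lra zify.
Set Implicit Arguments.
Unset Strict Implicit.
Unset Printing Implicit Defensive.

Local Open Scope classical_set_scope.
Local Open Scope ring_scope.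

(** * Counting grid points *)

(** A single comparison sets [n] counts at mesh [h] against [k - 1] times a count at mesh [h / 2],
    and the two kinds of count have ratio 2^d only up to a boundary error. Iterating [m] times gives
    n^m <= C ((k - 1) 2^d)^m with [C] independent of [m], and the constant disappears on taking m-th
    roots. If some box is covered fewer than [k - 1] times, every grid of small mesh loses a point
    there; this lowers the factor [k - 1] by a fixed amount and makes the bound strict, which drives
    the case of equality. No face lattice is built. An edge is known only through the reflections
    y_s + y_t - y_r, which may lie in the polytope for r = s and r = t alone; for an irredundant
    generator of the cone at a vertex this follows from uniqueness of its representation. Nor is
    conv X assumed to be full-dimensional: there are 2^|S| vertices for a minimal generating set S,
    and 2^d by counting multiplicities, whence |S| = d. *)

Lemma expr_bound_le (R : archiRealFieldType) (a b C : R) :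
  0 <= b -> (forall m : nat, a ^+ m <= C * b ^+ m) -> a <= b.
Proof.
move=> b0 H; rewrite leNgt; apply/negP => ba.
have a0 : 0 < a := le_lt_trans b0 ba.
have b1 : 0 < b.
  rewrite lt_def b0 andbT; apply/eqP => bE.
  by have := H 1%N; rewrite bE !expr1 mulr0 leNgt a0.
(* Bernoulli's inequality (1 + e)^m >= 1 + m e pushes (a / b)^m past every constant. *)
pose e := a / b - 1.
have e0 : 0 < e by rewrite subr_gt0 ltr_pdivlMr// mul1r.
have bern (m : nat) : 1 + m%:R * e <= (a / b) ^+ m.
  elim: m => [|m IH]; first by rewrite mul0r addr0 expr0.
  rewrite (_ : a / b = 1 + e) in IH *; last by rewrite /e; ring.
  rewrite exprS; have m0 : 0 <= m%:R :> R by [].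
  by rewrite -natr1; nra.
have bd (m : nat) : (a / b) ^+ m <= C.
  by rewrite expr_div_n ler_pdivrMr ?exprn_gt0.
have Ce : 0 <= C / e.
  apply: divr_ge0 (ltW e0); apply: le_trans (bd 0%N).
  by rewrite expr0.
have := Num.Theory.archi_boundP Ce; set m := Num.bound _ => Hm.
have := le_trans (bern m) (bd m).
rewrite leNgt; apply/negP; rewrite negbK.
by rewrite ltr_pdivrMr// in Hm; lra.
Qed.

Lemma esum_finType (R : realType) (T : finType) (a : T -> \bar R) :
  (forall t, 0 <= a t)%E -> \esum_(t in [set: T]) a t = (\sum_t a t)%E.
Proof.
move=> a0; rewrite esum_fset//; last exact: finite_finset.
rewrite [RHS]fsbig_seq ?index_enum_uniq//; apply: eq_fsbigl.
by apply/seteqP; split=> t //= _; rewrite mem_index_enum.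
Qed.

Section Grid.
Variables (R : realType) (d : nat).
Implicit Types (V : set 'rV[R]_d) (t : 'rV[R]_d) (h : R).

Definition int_vec (z : 'rV[int]_d) : 'rV[R]_d := map_mx intr z.

Definition bool_vec (b : {ffun 'I_d -> bool}) : 'rV[int]_d :=
  \row_i (b i : nat)%:Z.

(** An extended real sum, so that splitting and exchanging need no summability; finiteness comes
    from [grid_count_le]. *)
Definition grid_count h V t : \bar R :=
  (\esum_(z in [set: 'rV[int]_d]) (\1_V (t + h *: int_vec z))%:E)%E.

(** Integer vectors fall into 2^d parity classes, and each class is a translate of the grid of mesh
    [h]. *)
Lemma grid_count_half h V t :
  grid_count (h / 2) V t =
  (\sum_b grid_count h V (t + (h / 2) *: int_vec (bool_vec b)))%E.
Proof.
pose e (p : {ffun 'I_d -> bool} * 'rV[int]_d) := bool_vec p.1 + p.2 *+ 2.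
rewrite /grid_count (@reindex_esum _ _ _ [set: _] [set: _] e).
  rewrite -esum_finType; last by move=> b; apply: esum_ge0 => z _; rewrite lee_fin.
  rewrite esum_esum; last by move=> b z _ _; rewrite lee_fin.
  have -> : [set: {ffun 'I_d -> bool}] `*`` (fun=> [set: 'rV[int]_d]) = [set: _].
    by apply/seteqP; split.
  apply: eq_esum => -[b z] _ /=; congr (\1_V _)%:E.
  rewrite -addrA; congr (_ + _); apply/rowP => i; rewrite /int_vec !mxE /= mulr2n.
  by rewrite !intrD; field.
have parity (b : bool) (z : int) : ((b : nat)%:Z + (z + z) == 1 %[mod 2])%Z = b.
  rewrite (_ : _ + _ = z * 2 + (b : nat)%:Z); last by rewrite addrC mulr_natr.
  by rewrite modzMDl; case: b.
split=> //.
- move=> [b z] [b' z'] _ _ /rowP ee.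
  have be : b = b'.
    apply/ffunP => i; have := ee i; rewrite !mxE /= => ei.
    by rewrite -(parity (b i) (z ord0 i)) ei parity.
  rewrite be; congr pair; apply/rowP => i; have := ee i; rewrite !mxE /= be.
  by move/addrI; lia.
- move=> w _; exists ([ffun i => (w ord0 i == 1 %[mod 2])%Z], \row_i (w ord0 i %/ 2)%Z) => //.
  apply/rowP => i; rewrite !mxE ffunE.
  have := divz_eq (w ord0 i) 2; have := modz_ge0 (w ord0 i) (isT : 2 != 0 :> int).
  have := ltz_pmod (w ord0 i) (isT : 0 < 2 :> int).
  set q := (_ %/ _)%Z; set m := (_ %% _)%Z => m2 m0 ->.
  by case: m m0 m2 => [[|[|m]]|] //= _ _; lia.
Qed.

Lemma grid_count_le h V (M : R) : 0 < h ->
  (forall p, V p -> forall i, `|p 0 i| < M) ->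
  exists C : nat, forall t, (grid_count h V t <= C%:R%:E)%E.
Proof.
move=> h0 VM.
have [N HN] : exists N : nat, 2 * M / h + 1 < N%:R.
  exists (Num.bound `|2 * M / h + 1|); apply: le_lt_trans (ler_norm _) _.
  exact: Num.Theory.archi_boundP.
exists #|{ffun 'I_d -> 'I_N.+1}|%N => t.
(* In coordinate [i] the admissible integers lie in a window of length [N] from [a i] on, with [N]
   independent of the offset [t]. *)
pose a i : int := Num.floor ((- M - t 0 i) / h).
pose e (f : {ffun 'I_d -> 'I_N.+1}) : 'rV[int]_d := \row_i (a i + (f i : nat)%:Z).
have einj : injective e.
  move=> f g /rowP efg; apply/ffunP => i; apply/val_inj.
  by have := efg i; rewrite !mxE => /addrI [].
have -> : #|{ffun 'I_d -> 'I_N.+1}|%:R%:E =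
    (\esum_(z in range e) 1%:E :> \bar R)%E.
  rewrite esum_image; last by move=> f g _ _ /einj.
  by rewrite esum_finType// sumEFin sumr_const.
rewrite [leRHS]esum_mkcond; apply: le_esum => z _.
rewrite indicE; case: (boolP (_ \in V)) => [|_]; last by case: ifP.
rewrite inE => /VM zV; rewrite ifT// inE.
have az i : a i <= (z : 'rV__) ord0 i < a i + N%:Z.
  have := zV i; rewrite !mxE ltr_norml => /andP[z1 z2].
  have := floor_itv ((- M - t 0 i) / h); rewrite -/(a i) intrD.
  rewrite ler_pdivlMr// ltr_pdivrMr// => /andP[a1 a2].
  have hN : 2 * M + h < N%:R * h.
    have : (2 * M / h + 1) * h < N%:R * h by rewrite ltr_pM2r.
    by rewrite mulrDl mul1r divfK ?gt_eqF.
  apply/andP; split.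
    by rewrite -lerN2 -(ler_int R) -(ler_pM2r h0) !rmorphN /=; nra.
  by rewrite -(ltr_int R) -(ltr_pM2r h0) intrD; nra.
exists [ffun i => inord `|(z : 'rV__) ord0 i - a i|%N] => //.
apply/rowP => i; rewrite !mxE ffunE; have /andP[z1 z2] := az i.
rewrite inordK; last by lia.
by rewrite gez0_abs ?subr_ge0// [LHS]addrC subrK.
Qed.

Lemma grid_count_ge1 h V (c : 'rV[R]_d) (r : R) : 0 < h -> h <= r ->
  (forall p : 'rV[R]_d, (forall i, `|p 0 i - c 0 i| < r) -> V p) ->
  forall t, (1 <= grid_count h V t)%E.
Proof.
move=> h0 hr cV t.
pose z : 'rV[int]_d := \row_i Num.floor ((c 0 i - t 0 i) / h).
apply: esum_ge; exists [set z]; first by split.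
rewrite fsbig_set1 lee_fin indicE mem_set//; apply: cV => i.
rewrite /int_vec !mxE; have := floor_itv ((c 0 i - t 0 i) / h).
rewrite intrD; set y := _%:~R; rewrite ler_pdivlMr// ltr_pdivrMr// => /andP[y1 y2].
by rewrite ltr_norml; nra.
Qed.

(* Words of length m in the maps p |-> (p + x i) / 2: at scale m, the count sums
   over all such words the points of a grid of mesh h / 2 ^ m, with offset
   t / 2 ^ m, that lie in the corresponding image of U. *)
Fixpoint word_count (n : nat) (x : 'I_n -> 'rV[R]_d) h V (m : nat) t : \bar R :=
  if m is m'.+1 then (\sum_i @word_count n x h V m' (2 *: t - x i))%E
  else grid_count h V t.

(** The innermost layer is the one replaced: its tiles cost a factor [kappa] on the grid of half the
    mesh, which splits by parity. The outer maps only double the added offset, turning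
    [h / 2 ^+ m.+2] into [h / 2 ^+ m.+1]. *)
Lemma word_count_expand n (x : 'I_n -> 'rV[R]_d) h V (kappa : R) :
  0 <= kappa ->
  (forall t, (\sum_i grid_count h V (2 *: t - x i)
                <= kappa%:E * grid_count (h / 2) V t)%E) ->
  forall m t, (word_count x h V m.+1 t <=
    kappa%:E * \sum_b word_count x h V m
                (t + (h / 2 ^+ m.+1) *: int_vec (bool_vec b)))%E.
Proof.
move=> k0 H; elim=> [|m IH] t.
  by apply: le_trans (H t) _; rewrite grid_count_half expr1.
rewrite [leLHS]/=; apply: le_trans (lee_sum _ (fun i _ => IH _)) _.
rewrite -ge0_sume_distrr.
  rewrite exchange_big /=; apply: lee_wpmul2l; first by rewrite lee_fin.
  apply: lee_sum => b _; apply: lee_sum => i _.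
  rewrite le_eqVlt; apply/orP; left; apply/eqP; congr word_count.
  rewrite scalerDr scalerA addrAC; congr (_ + _ - _); congr (_ *: _).
  by rewrite (exprS _ m.+1); field; rewrite expf_neq0.
move=> i _; apply: sume_ge0 => b _.
elim: m {IH} (_ + _) => [|m IH] u /=; first by apply: esum_ge0 => z _; rewrite lee_fin.
by apply: sume_ge0.
Qed.

(** Each of the n^m words contributes at least one grid point, and each of the [m] expansions costs
    [kappa * 2 ^+ d], ending in a single grid count bounded by [C]. *)
Lemma tile_number_le n (x : 'I_n -> 'rV[R]_d) h V (C kappa : R) :
  0 <= kappa ->
  (forall t, (1 <= grid_count h V t <= C%:E)%E) ->
  (forall t, (\sum_i grid_count h V (2 *: t - x i)
                <= kappa%:E * grid_count (h / 2) V t)%E) ->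
  n%:R <= kappa * 2 ^+ d.
Proof.
move=> k0 V1C H.
apply: (@expr_bound_le _ _ _ C); first by rewrite mulr_ge0// exprn_ge0.
move=> m; rewrite -lee_fin.
have lb t : ((n%:R ^+ m : R)%:E <= word_count x h V m t)%E.
  elim: m t => [|m IH] t /=; first by rewrite expr0; have /andP[] := V1C t.
  apply: le_trans (lee_sum _ (fun i _ => IH _)).
  by rewrite sumEFin sumr_const card_ord exprS mulr_natl.
apply: le_trans (lb 0) _; move: (0 : 'rV[R]_d).
elim: m {lb} => [|m IH] t; first by rewrite expr0 mulr1; have /andP[] := V1C t.
apply: le_trans (word_count_expand k0 H _ _) _.
apply: le_trans (lee_wpmul2l _ (lee_sum _ (fun b _ => IH _))) _.
  by rewrite lee_fin.
rewrite sumEFin sumr_const card_ffun card_bool card_ord -EFinM lee_fin.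
by rewrite exprS -(mulr_natr _ (2 ^ d)) natrX le_eqVlt; apply/orP; left; apply/eqP; ring.
Qed.

(** * Tiles of bounded depth *)

Section Covering.
Variables (n k' : nat) (x : 'I_n -> 'rV[R]_d) (U : set 'rV[R]_d) (M r : R)
  (c : 'rV[R]_d).
Hypothesis UM : forall p, U p -> forall i, `|p 0 i| < M.
Hypothesis r0 : 0 < r.
Hypothesis cU : forall p : 'rV[R]_d, (forall i, `|p 0 i - c 0 i| < r) -> U p.
Hypothesis Ux : forall p i, U (2 *: p - x i) -> U p.

Definition tile_depth (p : 'rV[R]_d) : nat := #|[pred i | `[< U (2 *: p - x i) >]]|.

Lemma sum_grid_count h t : (\sum_i grid_count h U (2 *: t - x i))%E =
  (\esum_(z in [set: 'rV[int]_d]) (tile_depth (t + (h / 2) *: int_vec z))%:R%:E)%E.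
Proof.
rewrite /grid_count -esum_sum; last by move=> z i _ _; rewrite lee_fin.
apply: eq_esum => z _; rewrite sumEFin; congr (_%:E).
rewrite /tile_depth -sum1_card natr_sum [RHS]big_mkcond; apply: eq_bigr => i _ /=.
rewrite indicE (_ : _ - _ + _ = 2 *: (t + (h / 2) *: int_vec z) - x i).
  by rewrite inE; case: asboolP => H; rewrite ?(mem_set H)// memNset.
by rewrite scalerDr scalerA addrAC; congr (_ + _ *: _ - _); field.
Qed.

Lemma le_grid_count h V W t : V `<=` W -> (grid_count h V t <= grid_count h W t)%E.
Proof.
move=> VW; apply: le_esum => z _; rewrite lee_fin !indicE.
by case: (boolP (_ \in V)); rewrite ?ler0n// inE => /VW /mem_set ->.
Qed.

(** The set [B] records where the depth falls short of [k'], so its grid points fit on the left.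
    Points outside [U] lie in no tile, which is why only depths in [U] matter. *)
Lemma sum_grid_count_le h t (B : set 'rV[R]_d) :
  (forall p, U p -> (tile_depth p + `[< B p >] <= k')%N) ->  B `<=` U ->
  (\sum_i grid_count h U (2 *: t - x i) + grid_count (h / 2) B t
     <= k'%:R%:E * grid_count (h / 2) U t)%E.
Proof.
move=> UB BU; rewrite sum_grid_count /grid_count -esumD//.
have -> (S : \bar R) : (k'%:R%:E * S = \sum_(i < k') S)%E.
  by rewrite mule_natl sumr_const card_ord.
rewrite -esum_sum; last by move=> z i _ _; rewrite lee_fin.
apply: le_esum => z _; rewrite sumEFin sumr_const card_ord -EFinD lee_fin.
set p := t + _; rewrite !indicE -[leRHS]mulr_natr -natrM -natrD ler_nat.
have -> : (p \in B) = `[< B p >] by [].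
have [Up|nUp] := pselect (U p); first by rewrite (mem_set Up) mul1n UB.
rewrite asboolF ?addn0; last by move=> /BU.
rewrite (_ : tile_depth p = 0%N) //; apply: eq_card0 => i; apply/negbTE/negP => /asboolP.
by move=> /Ux.
Qed.

Lemma tile_number_bound : (forall p, (tile_depth p <= k')%N) -> (n <= k' * 2 ^ d)%N.
Proof.
move=> Hk; rewrite -(ler_nat R) natrM natrX.
have [C HC] := grid_count_le r0 UM.
apply: (@tile_number_le _ x r U C%:R) => // t.
  by rewrite HC andbT; exact: (grid_count_ge1 r0 (lexx r) cU).
apply: le_trans (sum_grid_count_le r t (B := set0) _ _) => //.
  by rewrite leeDl// esum_ge0// => z _; rewrite lee_fin.
by move=> p _; rewrite asboolF// addn0.
Qed.

(** The deficient box catches a point of every grid of mesh [h / 2], while [U] holds at most [C'] of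
    its points. The deficit is thus a fixed proportion, and the factor [k'] improves to k' -
    1/C'. *)
Lemma tile_number_bound_lt (r' : R) (c' : 'rV[R]_d) : 0 < r' ->
  (forall p, (tile_depth p <= k')%N) ->
  (forall p : 'rV[R]_d, (forall i, `|p 0 i - c' 0 i| < r') ->
     U p /\ (tile_depth p < k')%N) ->
  (n < k' * 2 ^ d)%N.
Proof.
move=> r'0 Hk HB; rewrite -(ltr_nat R) natrM natrX.
(* The first bound makes the grid of mesh [h] meet [U], the second makes the grid of mesh [h / 2]
   meet the deficient box. *)
pose h := Num.min r (2 * r').
have h0 : 0 < h by rewrite lt_min r0 mulr_gt0.
have hr : h <= r by rewrite ge_min lexx.
have hr' : h / 2 <= r' by rewrite ler_pdivrMr// mulrC ge_min lexx orbT.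
have h20 : 0 < h / 2 by rewrite divr_gt0.
have [C HC] := grid_count_le h0 UM.
have [C' HC'] := grid_count_le h20 UM.
pose B := [set p : 'rV[R]_d | forall i, `|p 0 i - c' 0 i| < r'].
have BU : B `<=` U by move=> p /HB[].
have B1 t : (1 <= grid_count (h / 2) B t)%E by exact: (grid_count_ge1 (c := c') h20 hr').
have C'1 : 1 <= C'%:R :> R.
  by rewrite -lee_fin; apply: le_trans (HC' 0); apply: le_trans (B1 0) (le_grid_count _ _ BU).
have C'0 : 0 < C'%:R :> R by apply: lt_le_trans C'1.
have k'1 : 1 <= k'%:R :> R.
  rewrite ler1n; have [|_] := HB c'; last exact: leq_ltn_trans.
  by move=> i; rewrite subrr normr0.
apply: (@le_lt_trans _ _ ((k'%:R - C'%:R^-1) * 2 ^+ d)); last first.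
  by rewrite ltr_pM2r ?exprn_gt0// ltrBlDr ltrDl invr_gt0.
apply: (@tile_number_le _ x h U C%:R) => [|t|t].
- by rewrite subr_ge0; apply: le_trans k'1; rewrite invf_le1.
- by rewrite HC andbT; exact: (grid_count_ge1 h0 hr cU).
have : (\sum_i grid_count h U (2 *: t - x i) + 1
     <= k'%:R%:E * grid_count (h / 2) U t)%E.
  apply: le_trans (sum_grid_count_le h t (B := B) _ BU).
    by rewrite leeD2l.
  move=> p _; case: asboolP => [/HB[_]|_]; last by rewrite addn0.
  by rewrite addn1.
have : (0 <= grid_count (h / 2) U t)%E by apply: esum_ge0 => z _; rewrite lee_fin.
move: (HC' t); move: (grid_count (h / 2) U t) => [g||]//.
rewrite !lee_fin => gC g0.
move: (\sum_i _)%E => [S||] //; last by move=> _; rewrite -EFinM leNye.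
rewrite -?EFinD -?EFinM ?lee_fin//.
have : C'%:R^-1 * g <= 1 by rewrite ler_pdivrMl// mulr1.
by nra.
Qed.

End Covering.

End Grid.

(** * Antipodal pairs and the cardinality bound *)

Section Functionals.
Variables (R : realType) (d : nat).
Implicit Types (u : 'cV[R]_d) (p q : 'rV[R]_d).

Definition lf u p : R := (p *m u) 0 0.

Lemma lfD u p q : lf u (p + q) = lf u p + lf u q.
Proof. by rewrite /lf mulmxDl mxE. Qed.

Lemma lfN u p : lf u (- p) = - lf u p.
Proof. by rewrite /lf mulNmx mxE. Qed.

Lemma lfB u p q : lf u (p - q) = lf u p - lf u q.
Proof. by rewrite lfD lfN. Qed.

Lemma lfZ u a p : lf u (a *: p) = a * lf u p.
Proof. by rewrite /lf -scalemxAl mxE. Qed.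

Lemma lf0 u : lf u 0 = 0.
Proof. by rewrite /lf mul0mx mxE. Qed.

Lemma lf_sum (I : Type) (r : seq I) (P : pred I) (F : I -> 'rV[R]_d) u :
  lf u (\sum_(i <- r | P i) F i) = \sum_(i <- r | P i) lf u (F i).
Proof. by rewrite /lf mulmx_suml summxE. Qed.

Lemma lfE u p : lf u p = \sum_i p 0 i * u i 0.
Proof. by rewrite /lf mxE. Qed.

Lemma lf_Nl u p : lf (- u) p = - lf u p.
Proof. by rewrite /lf mulmxN mxE. Qed.

Lemma lf_Zl a u p : lf (a *: u) p = a * lf u p.
Proof. by rewrite /lf -scalemxAr mxE. Qed.

Lemma lf_continuous u : continuous (lf u).
Proof.
move=> p; rewrite [lf u](_ : _ = fun p => \sum_i p 0 i * u i 0); last first.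
  by apply/funext => q; rewrite lfE.
apply: cvg_big => [||i _]; [exact: add_continuous|exact: (nbhs_filter p)|].
by apply: (@cvgMl _ _ _ (nbhs_filter p)); exact: coord_continuous.
Qed.

Lemma nbhs_box (V : set 'rV[R]_d) (c : 'rV[R]_d) : nbhs c V ->
  exists2 r : R, 0 < r & forall p : 'rV[R]_d, (forall i, `|p 0 i - c 0 i| < r) -> V p.
Proof.
move=> /nbhs_ballP[r /= r0 rV].
exists r => // p pc; apply: rV; split=> // i j.
by rewrite (ord1 i) /ball /= distrC; exact: pc.
Qed.

Lemma family_bound (T : finType) (y : T -> 'rV[R]_d) :
  exists2 M : R, 0 < M & forall t i, `|y t 0 i| < M.
Proof.
exists (1 + \sum_t \sum_i `|y t 0 i|).
  by rewrite ltr_wpDr// !sumr_ge0// => t _; rewrite sumr_ge0.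
move=> t i; apply: (@le_lt_trans _ _ (\sum_t \sum_i `|y t 0 i|)); last by rewrite ltrDr.
rewrite (bigD1 t)//= (bigD1 i)//= -addrA lerDl addr_ge0// !sumr_ge0// => *.
by rewrite sumr_ge0.
Qed.

Definition separates (T : Type) (y : T -> 'rV[R]_d) (s t : T) u : Prop :=
  lf u (y s) < lf u (y t) /\ forall r, lf u (y s) <= lf u (y r) <= lf u (y t).

(** The index type is arbitrary because families of vertices are treated too; for configurations,
    [antipodal_hyperplanes] identifies this with the geometric notion. *)
Definition antipodal (T : Type) (y : T -> 'rV[R]_d) (s t : T) : Prop :=
  exists u, separates y s t u.

Lemma antipodal_sym (T : Type) (y : T -> 'rV[R]_d) s t :
  antipodal y s t -> antipodal y t s.
Proof.
move=> [u [st H]]; exists (- u); rewrite /separates !lf_Nl ltrN2; split=> // r.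
by have /andP[] := H r; rewrite lf_Nl !lerN2 => -> ->.
Qed.

Lemma separating_functionals (T : Type) (y : T -> 'rV[R]_d) :
  exists w : T -> T -> 'cV[R]_d, forall s t, antipodal y s t -> separates y s t (w s t).
Proof.
have [|w Hw] := @choice (T * T)%type 'cV[R]_d
  (fun st u => antipodal y st.1 st.2 -> separates y st.1 st.2 u); last first.
  by exists (fun s t => w (s, t)) => s t; exact: (Hw (s, t)).
move=> [s t] /=; have [[u Hu]|nst] := pselect (antipodal y s t).
  by exists u.
by exists 0 => /nst.
Qed.

End Functionals.

(** * The slab polytope and its half-size tiles *)

Section Slabs.
Variables (R : realType) (d n k' : nat) (x : 'I_n -> 'rV[R]_d).
Variables (w : 'I_n -> 'I_n -> 'cV[R]_d) (M : R).
Hypothesis wP : forall i j, antipodal x i j -> separates x i j (w i j).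
Hypothesis M0 : 0 < M.
Hypothesis xM : forall l i, `|x l 0 i| < M.
Hypothesis kP : forall A : {set 'I_n}, (k' < #|A|)%N ->
  exists a b, [/\ a \in A, b \in A & antipodal x a b].

(** The relation [lt] gives the open and the closed version together. The box of half-width [M]
    keeps both bounded, whatever the antipodal pairs are. *)
Definition slabs (lt : rel R) : set 'rV[R]_d :=
  [set p : 'rV[R]_d | (forall i, lt `|p 0 i| M) /\
     forall i j, antipodal x i j ->
       lt (lf (w i j) (x i)) (lf (w i j) p) /\ lt (lf (w i j) p) (lf (w i j) (x j))].

Let U := slabs <%R.
Let P := slabs <=%R.

(** [p] is the midpoint of [2 *: p - x i] and [x i]. The point [x i] satisfies the slab inequalities
    weakly, so strictness is inherited from the other endpoint. *)
Lemma slabs_mid (lt : rel R) p i :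
  lt = <%R \/ lt = <=%R -> slabs lt (2 *: p - x i) -> slabs lt p.
Proof.
have coord a b : `|2 * a - b| < M \/ `|2 * a - b| <= M -> `|b| < M -> `|a| < M.
  rewrite !ltr_norml !ler_norml => -[] /andP[? ?] /andP[? ?]; lra.
move=> ltE [pM ps]; split=> [j|a b ab].
  have := pM j; rewrite !mxE => H; have {H} : `|p 0 j| < M.
    by apply: coord (xM i j); case: ltE H => ->; [left|right].
  by case: ltE => -> // /ltW.
have [_ /(_ i) /andP[ai ib]] := wP ab.
have := ps a b ab; rewrite lfB lfZ.
by case: ltE => -> [? ?]; split; lra.
Qed.

(** For an antipodal pair a, b, membership of [p] in both open tiles would put w(2p) strictly below
    and strictly above w(x_a) + w(x_b). *)
Lemma slabs_depth p : (tile_depth x U p <= k')%N.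
Proof.
rewrite leqNgt; apply/negP => H.
have [|a [b [aA bA ab]]] := kP (A := [set i | `[< U (2 *: p - x i) >]]).
  by rewrite cardsE.
move: aA bA; rewrite !inE => /asboolP/asboolP Ua /asboolP/asboolP Ub.
have [[_ Ha] [_ Hb]] := (Ua, Ub).
have [_] := Ha a b ab; have [+ _] := Hb a b ab.
by rewrite !lfB !lfZ; lra.
Qed.

Definition centroid : 'rV[R]_d := n%:R^-1 *: \sum_l x l.

(** In each averaged inequality the term of the opposite end of the pair is strict, so [U] is
    nonempty even if the points span a proper affine subspace. *)
Lemma centroid_slabs : (0 < n)%N -> U centroid.
Proof.
move=> n0; have n0' : 0 < n%:R :> R by rewrite ltr0n.
have sumE (a : R) : \sum_(l < n) a = a * n%:R by rewrite sumr_const card_ord mulr_natr.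
split=> [i|i j ij].
  rewrite /centroid mxE summxE normrM gtr0_norm ?invr_gt0// mulrC ltr_pdivrMr//.
  apply: le_lt_trans (ler_norm_sum _ _ _) _; rewrite -sumE.
  apply: ltr_sum => //; by apply/hasP; exists (Ordinal n0); rewrite ?mem_index_enum.
have [ij' H] := wP ij.
rewrite /centroid lfZ lf_sum mulrC ltr_pdivlMr// ltr_pdivrMr// -!sumE.
have strict (F G : 'I_n -> R) l0 : (forall l, F l <= G l) -> F l0 < G l0 ->
    \sum_l F l < \sum_l G l.
  move=> FG FG0; rewrite (bigD1 l0)//= [ltRHS](bigD1 l0)//=.
  by rewrite ltr_leD// ler_sum.
split; [apply: (strict _ _ j)|apply: (strict _ _ i)] => // l; by have /andP[] := H l.
Qed.

Lemma slabs_open : open U.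
Proof.
rewrite openE => p [pM ps]; rewrite /interior /U /slabs /=.
have near_lf u a : lf u p < a -> \forall q \near p, lf u q < a.
  by move=> pa; apply: (@cvgr_lt _ _ _ (nbhs_filter p) _ _ _ _ pa); exact: lf_continuous.
have near_gt u a : a < lf u p -> \forall q \near p, a < lf u q.
  by move=> pa; apply: (@cvgr_gt _ _ _ (nbhs_filter p) _ _ _ _ pa); exact: lf_continuous.
apply: filterI.
  apply: (@filter_forall _ _ (fun i q => `|(q : 'rV[R]_d) 0 i| < M) _ (nbhs_filter p)) => i.
  by apply: (@cvgr_norm_lt _ _ _ _ (nbhs_filter p) _ _ _ _ (pM i)); exact: coord_continuous.
apply: (@filter_forall _ _ (fun i q => forall j, _) _ (nbhs_filter p)) => i.
apply: (@filter_forall _ _ (fun j q => antipodal x i j -> _) _ (nbhs_filter p)) => j.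
apply: (@filter_imply _ _ _ _ (nbhs_filter p)) => ij; have [] := ps i j ij => ? ?.
by apply: filterI; [apply: near_gt|apply: near_lf].
Qed.

Lemma slabs_closed : closed P.
Proof.
have cl (f : 'rV[R]_d -> R) a : continuous f -> closed [set p | f p <= a].
  by move=> /continuous_closedP cf; exact: cf (@closed_le _ a).
have cg (f : 'rV[R]_d -> R) a : continuous f -> closed [set p | a <= f p].
  by move=> /continuous_closedP cf; exact: cf (@closed_ge _ a).
have -> : P = \bigcap_i [set p : 'rV[R]_d | `|p 0 i| <= M] `&`
  \bigcap_(ij in [set ij | antipodal x ij.1 ij.2])
    ([set p | lf (w ij.1 ij.2) (x ij.1) <= lf (w ij.1 ij.2) p] `&`
     [set p | lf (w ij.1 ij.2) p <= lf (w ij.1 ij.2) (x ij.2)]).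
  apply/seteqP; split=> p [pM ps]; split=> //.
  - by move=> i _; exact: pM.
  - by move=> [i j] /= ij; exact: ps.
  - by move=> i; exact: pM.
  - by move=> i j ij; exact: (ps (i, j)).
apply: closedI; apply: closed_bigI; [move=> i _|move=> [i j] /= _].
  apply: (cl (fun p => `|p 0 i|)) => p.
  by apply: (@cvg_norm _ _ _ _ (nbhs_filter p)); exact: coord_continuous.
by apply: closedI; [apply: cg|apply: cl]; exact: lf_continuous.
Qed.

Lemma antipodal_bound : (n <= k' * 2 ^ d)%N.
Proof.
have [->//|n0] := posnP n.
have [r r0 rU] := nbhs_box (open_nbhs_nbhs (conj slabs_open (centroid_slabs n0))).
apply: (@tile_number_bound _ _ _ _ x U M r centroid) => //.
- by move=> p [].
- by move=> p i; apply: slabs_mid; left.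
- exact: slabs_depth.
Qed.

(** Since the tiles are closed and finite in number, a point in fewer than [k'] of them has a
    neighbourhood of such points. Moving slightly towards the centroid reaches a box inside [U],
    where [tile_number_bound_lt] applies. *)
Lemma slabs_cover p : n = (k' * 2 ^ d)%N -> P p ->
  (k' <= #|[pred i : 'I_n | `[< P (2 *: p - x i)%R >]]|)%N.
Proof.
move=> nE Pp; rewrite leqNgt; apply/negP => Hk.
have k0 : (0 < k')%N by apply: leq_ltn_trans Hk.
have n0 : (0 < n)%N by rewrite nE muln_gt0 k0 expn_gt0.
have [r r0 rP] : exists2 r : R, 0 < r & forall q : 'rV[R]_d, (forall i, `|q 0 i - p 0 i| < r) ->
    forall i, P (2 *: q - x i) -> P (2 *: p - x i).
  apply: (@nbhs_box _ _ [set q | forall i, P (2 *: q - x i) -> P (2 *: p - x i)]).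
  apply: (@filter_forall _ _ (fun i q => P (2 *: q - x i) -> P (2 *: p - x i)) _ (nbhs_filter p)) => i.
  have [Pi|nPi] := pselect (P (2 *: p - x i)); first exact: nearW.
  suff : \forall q \near p, (~` P) (2 *: q - x i) by apply: filterS => q nP /nP.
  have oP : open (~` P) by apply: closed_openC; exact: slabs_closed.
  have : (2 *: q - x i) @[q --> p] --> 2 *: p - x i.
    apply: (@cvgB _ _ _ _ (nbhs_filter p)); last exact: cvg_cst.
    by apply: (@cvgZr _ _ _ _ (nbhs_filter p)); exact: cvg_id.
  by move/(_ _ (open_nbhs_nbhs (conj oP nPi))).
have [c0 cs] := centroid_slabs n0; move: centroid c0 cs => c c0 cs.
(* Coordinates of [c - p] are below 2M in absolute value, so this [e] shifts each coordinate of [p]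
   by less than r/2. *)
pose e := r / (r + 4 * M).
have e0 : 0 < e by rewrite divr_gt0// addr_gt0// mulr_gt0.
have eM : e * (4 * M) = r * (1 - e) by rewrite /e; field; rewrite gt_eqF// addr_gt0// mulr_gt0.
have e1 : e < 1 by rewrite ltr_pdivrMr ?mul1r ?ltrDl ?addr_gt0 ?mulr_gt0.
pose q := p + e *: (c - p).
have [pM ps] := Pp.
have Uq : U q.
  split=> [i|i j ij].
    rewrite !mxE; have := pM i; have := c0 i.
    by rewrite ltr_norml ler_norml ltr_norml => /andP[? ?] /andP[? ?]; nra.
  rewrite lfD lfZ lfB; have := ps i j ij; have := cs i j ij.
  by move=> [? ?] [? ?]; nra.
have qp i : `|q 0 i - p 0 i| < r / 2.
  rewrite !mxE; have := pM i; have := c0 i.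
  by rewrite ltr_norml ler_norml ltr_norml => /andP[? ?] /andP[? ?]; nra.
have [r' r'0 r'U] := nbhs_box (open_nbhs_nbhs (conj slabs_open Uq)).
suff : (n < k' * 2 ^ d)%N by rewrite nE ltnn.
apply: (@tile_number_bound_lt _ _ _ _ x U M r' q _ _ _ _ (Num.min (r / 2) r') q) => //.
- by move=> z [].
- by move=> z i; apply: slabs_mid; left.
- by rewrite lt_min divr_gt0.
- exact: slabs_depth.
move=> z zq; have Uz : U z.
  by apply: r'U => i; apply: lt_le_trans (zq i) _; rewrite ge_min lexx orbT.
split=> //; apply: leq_ltn_trans Hk; apply: subset_leq_card.
apply/fintype.subsetP => i; rewrite !inE => /asboolP/asboolP Uzi; apply/asboolP/asboolP.
apply: (rP z) => [j|].
  have := qp j; have : `|z 0 j - q 0 j| < r / 2.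
    by apply: lt_le_trans (zq j) _; rewrite ge_min lexx.
  by rewrite !ltr_norml => /andP[? ?] /andP[? ?]; lra.
case: Uzi => zM zs; split=> [j|a b ab]; first by rewrite ltW.
by have [? ?] := zs a b ab; split; rewrite ltW.
Qed.

End Slabs.

(** * The extremal polytope is a cube *)

Section Hull.
Variables (R : realType) (d : nat).

Definition hull (T : finType) (y : T -> 'rV[R]_d) : set 'rV[R]_d :=
  [set p | exists a : T -> R,
     [/\ forall t, 0 <= a t, \sum_t a t = 1 & p = \sum_t a t *: y t]].

Variables (T : finType) (y : T -> 'rV[R]_d).

Lemma sum_enum_val (V : nmodType) (F : T -> V) :
  \sum_t F t = \sum_(i < #|T|) F (enum_val i).
Proof.
apply: reindex; exists enum_rank => t _; [exact: enum_valK|exact: enum_rankK].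
Qed.

Lemma hull_point t : hull y (y t).
Proof.
exists (fun s => (s == t)%:R); split=> [s||]; first by rewrite ler0n.
  by rewrite (bigD1 t)//= eqxx big1 ?addr0// => s /negbTE ->.
rewrite (bigD1 t)//= eqxx scale1r big1 ?addr0// => s /negbTE ->.
by rewrite scale0r.
Qed.

Lemma hull_convex p q s : 0 <= s <= 1 -> hull y p -> hull y q ->
  hull y ((1 - s) *: p + s *: q).
Proof.
move=> /andP[s0 s1] [a [a0 a1 ->]] [b [b0 b1 ->]].
exists (fun t => (1 - s) * a t + s * b t); split.
- by move=> t; rewrite addr_ge0// mulr_ge0// subr_ge0.
- by rewrite big_split/= -!mulr_sumr a1 b1; ring.
- rewrite !scaler_sumr -big_split/=; apply: eq_bigr => t _.
  by rewrite !scalerA -scalerDl.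
Qed.

Lemma hull_le u c p : (forall t, lf u (y t) <= c) -> hull y p -> lf u p <= c.
Proof.
move=> uc [a [a0 a1 ->]]; rewrite lf_sum -[c]mul1r -a1 mulr_suml.
by apply: ler_sum => t _; rewrite lfZ ler_wpM2l.
Qed.

Lemma hull_ge u c p : (forall t, c <= lf u (y t)) -> hull y p -> c <= lf u p.
Proof.
move=> uc yp; rewrite -lerN2 -lf_Nl; apply: hull_le yp => t.
by rewrite lf_Nl lerN2.
Qed.

Lemma hull_comb (I : finType) (A : pred I) (b : I -> R) (c : I -> 'rV[R]_d) :
  (forall i, A i -> 0 <= b i) -> \sum_(i | A i) b i = 1 ->
  (forall i, A i -> hull y (c i)) -> hull y (\sum_(i | A i) b i *: c i).
Proof.
move=> b0 b1 yc.
have [|w wP] := @choice I (T -> R) (fun i w => A i ->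
    [/\ forall t, 0 <= w t, \sum_t w t = 1 & c i = \sum_t w t *: y t]).
  by move=> i; have [/yc[w wP]|] := boolP (A i); [exists w|exists (fun=> 0)].
exists (fun t => \sum_(i | A i) b i * w i t); split.
- move=> t; apply: sumr_ge0 => i Ai; have [w0 _ _] := wP i Ai.
  by rewrite mulr_ge0// b0.
- rewrite exchange_big -[RHS]b1 /=; apply: eq_bigr => i Ai; have [_ w1 _] := wP i Ai.
  by rewrite -mulr_sumr w1 mulr1.
- under [RHS]eq_bigr do rewrite scaler_suml.
  rewrite exchange_big /=; apply: eq_bigr => i Ai; have [_ _ ->] := wP i Ai.
  by rewrite scaler_sumr; apply: eq_bigr => t _; rewrite scalerA.
Qed.

Lemma hull_sub (T' : finType) (y' : T' -> 'rV[R]_d) :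
  (forall t, hull y (y' t)) -> hull y' `<=` hull y.
Proof. by move=> yy' _ [a [a0 a1 ->]]; apply: hull_comb. Qed.

Lemma hull_closed : closed (hull y).
Proof.
pose f (a : 'rV[R]_#|T|) : 'rV[R]_d := \sum_i a 0 i *: y (enum_val i).
pose A := [set a : 'rV[R]_#|T| | (forall i, a 0 i \in `[0, 1]) /\ \sum_i a 0 i = 1].
have -> : hull y = f @` A.
  apply/seteqP; split=> [p [a [a0 a1 ->]]|_ [a [a0 a1] <-]].
    rewrite sum_enum_val in a1; exists (\row_i a (enum_val i)).
      split=> [i|]; last by rewrite -a1; apply: eq_bigr => i _; rewrite mxE.
      rewrite mxE in_itv/= a0 -a1 (bigD1 i)//= lerDl.
      by apply: sumr_ge0.
    by rewrite /f sum_enum_val; apply: eq_bigr => i _; rewrite mxE.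
  exists (fun t => a 0 (enum_rank t)); split=> [t||].
  - by have := a0 (enum_rank t); rewrite in_itv/= => /andP[].
  - by rewrite -a1 sum_enum_val; apply: eq_bigr => i _; rewrite enum_valK.
  - by rewrite /f sum_enum_val; apply: eq_bigr => i _; rewrite enum_valK.
apply: compact_closed; first exact: norm_hausdorff.
apply: continuous_compact.
  apply: continuous_subspaceT => a.
  apply: cvg_big => [||i _]; [exact: add_continuous|exact: (nbhs_filter a)|].
  by apply: (@cvgZr_tmp _ _ _ _ (nbhs_filter a)); exact: coord_continuous.
have -> : A = [set a : 'rV[R]_#|T| | forall i, a ord0 i \in `[0, 1]] `&`
    (fun a : 'rV[R]_#|T| => \sum_i a 0 i) @^-1` [set 1].
  by apply/seteqP; split=> a [].
apply: compact_closedI; last first.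
  apply: (continuous_closedP _).1; last exact: closed_eq.
  move=> a; apply: cvg_big => [||i _]; [exact: add_continuous|exact: (nbhs_filter a)|].
  exact: coord_continuous.
apply: (@rV_compact _ _ (fun=> `[(0 : R), 1]%classic)) => i.
exact: segment_compact.
Qed.

Lemma closed_ray (C : set 'rV[R]_d) p v : closed C ->
  (forall h : R, 0 < h <= 1 -> C (p + h *: v)) -> C p.
Proof.
move=> Ccl Ch; apply: contrapT => nCp.
have [r r0 rC] := nbhs_box (open_nbhs_nbhs (conj (closed_openC Ccl) nCp)).
have [b b0 vb] : exists2 b : R, 0 < b & forall i, `|v 0 i| < b.
  exists (1 + \sum_i `|v 0 i|); first by rewrite ltr_wpDr// sumr_ge0.
  move=> i; rewrite (bigD1 i)//=; set s := \sum_(_ < _ | _) _.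
  have : 0 <= s by apply: sumr_ge0.
  lra.
have rb0 : 0 < r / (b + r) by rewrite divr_gt0// addr_gt0.
apply: (rC (p + (r / (b + r)) *: v)) => [i|].
  rewrite !mxE addrAC subrr add0r normrM gtr0_norm// mulrAC ltr_pdivrMr ?addr_gt0//.
  by rewrite ltr_pM2l//; apply: lt_trans (vb i) _; rewrite ltrDl.
by apply: Ch; rewrite rb0 ler_pdivrMr ?addr_gt0// mul1r lerDr ltW.
Qed.

(** Each point of [P] is the midpoint of some [y t] and another point of [P]; repeating this
    approximates it by hull points with error of order 2^-m, and the hull is closed. *)
Lemma hull_cover (P : set 'rV[R]_d) M : (forall p, P p -> forall i, `|p 0 i| <= M) ->
  (forall p, P p -> exists t, P (2 *: p - y t)) -> P `<=` hull y.
Proof.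
move=> PM Pcov p Pp.
have [B Bp] : exists B : R, forall q, hull y q -> forall i, `|q 0 i| <= B.
  exists (\sum_t \sum_i `|y t 0 i|) => _ [a [a0 a1 ->]] i.
  rewrite summxE; apply: le_trans (ler_norm_sum _ _ _) _; apply: ler_sum => t _.
  rewrite mxE normrM ger0_norm// (bigD1 i)//= -[leLHS]addr0 lerD ?sumr_ge0//.
  rewrite ler_piMl// -a1 (bigD1 t)//= lerDl.
  by apply: sumr_ge0.
have approx (m : nat) q : P q -> exists2 z, hull y z &
    forall i, `|q 0 i - z 0 i| * 2 ^+ m <= M + B.
  elim: m q => [|m IH] q Pq.
    have [t _] := Pcov q Pq; exists (y t); first exact: hull_point.
    move=> i; rewrite expr0 mulr1; apply: le_trans (ler_normB _ _) _.
    by rewrite lerD// ?PM// Bp//; exact: hull_point.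
  have [t /IH[z yz zq]] := Pcov q Pq.
  exists ((1 - 2^-1) *: z + 2^-1 *: y t).
    apply: hull_convex yz (hull_point t).
    by rewrite invr_ge0 ler0n invf_le1// ler1n.
  move=> i; apply: le_trans (zq i); rewrite !mxE exprS mulrA ler_pM2r ?exprn_gt0//.
  rewrite le_eqVlt; apply/orP; left; apply/eqP.
  rewrite -[X in _ * X](@ger0_norm _ 2)// -normrM; congr `|_|.
  by field.
apply: contrapT => nyp.
have [r r0 rC] := nbhs_box (open_nbhs_nbhs (conj (closed_openC hull_closed) nyp)).
pose m := Num.bound ((M + B) / r).
have mr : (M + B) / r < 2 ^+ m by apply: upper_nthrootP.
rewrite ltr_pdivrMr// in mr.
have [z yz zp] := approx m p Pp.
apply: (rC z) yz => i; rewrite distrC.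
have m0 : 0 < 2 ^+ m :> R by rewrite exprn_gt0.
by rewrite -(ltr_pM2r m0); apply: le_lt_trans (zp i) _; rewrite mulrC.
Qed.

End Hull.

(** * Pairwise antipodal points whose tiles cover their hull *)

Section Cube.
Variables (R : realType) (d : nat) (T : finType) (y : T -> 'rV[R]_d).

Let P := hull y.

Hypothesis coverP : forall p, P p -> exists t, P (2 *: p - y t).
Hypothesis antipodalP : forall s t, s != t -> antipodal y s t.

Lemma pairwise_antipodal_inj : injective y.
Proof.
move=> s t yst; apply/eqP; apply: contraT => /antipodalP[u [+ _]].
by rewrite yst ltxx.
Qed.

Definition normalized (s t : T) (u : 'cV[R]_d) :=
  lf u (y t - y s) = 1 /\ forall p, P p -> 0 <= lf u (p - y s) <= 1.

Lemma normalized_functional s t : s != t -> exists u, normalized s t u.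
Proof.
move=> /antipodalP[u [ust H]].
have c0 : 0 < lf u (y t) - lf u (y s) by rewrite subr_gt0.
exists ((lf u (y t) - lf u (y s))^-1 *: u); split.
  by rewrite lf_Zl lfB mulVf// gt_eqF.
move=> p Pp; rewrite lf_Zl lfB mulrC divr_ge0 ?(ltW c0) ?subr_ge0//=; last first.
  by apply: hull_ge Pp => r; have /andP[] := H r.
rewrite ler_pdivrMr// mul1r lerD2r.
by apply: hull_le Pp => r; have /andP[] := H r.
Qed.

(** Along [y_s, y_t] a functional already sweeps its whole range on [P], so no parallel chord is
    longer. *)
Lemma affine_diameter s t z (c : R) : s != t -> P z -> P (z + c *: (y t - y s)) -> c <= 1.
Proof.
move=> /normalized_functional[u [u1 uP]] /uP/andP[z0 z1] /uP/andP[_].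
rewrite addrAC lfD lfZ u1 => z2.
lra.
Qed.

(* The midpoint of the edge [y s, y t] only lies in the two tiles (P + y s) / 2
   and (P + y t) / 2, which the functional u separates; near this midpoint the
   first must cover the half u <= 1/2 and the second the half u >= 1/2. *)
Lemma edge_split s t u : normalized s t u ->
  (forall r, P (y s + y t - y r) -> r = s \/ r = t) ->
  forall p, P p -> exists2 h : R, 0 < h &
    let v := (p - y s) - lf u (p - y s) *: (y t - y s) in
    P (y s + h *: v) /\ P (y t + h *: v).
Proof.
move=> [u1 uP] edge p Pp.
have Pcl : closed P by exact: hull_closed.
(* [P] is closed and there are finitely many [r], so the other tiles stay away from a neighbourhood
   of the midpoint. *)
have [e e0 eP] : exists2 e : R, 0 < e & forall v : 'rV[R]_d, (forall i, `|v 0 i| < e) ->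
    forall r, P (y s + y t - y r + v) -> r = s \/ r = t.
  have [|e e0 H] := @nbhs_box _ _
    [set v | forall r, P (y s + y t - y r + v) -> r = s \/ r = t] 0.
    apply: (@filter_forall _ _ (fun r v => P (y s + y t - y r + v) -> r = s \/ r = t)
      _ (nbhs_filter (0 : 'rV[R]_d))) => r.
    have [/edge rst|nP] := pselect (P (y s + y t - y r)); first exact: nearW.
    suff : \forall v \near (0 : 'rV[R]_d), (~` P) (y s + y t - y r + v).
      by apply: filterS => v nPv /nPv.
    have oP := closed_openC Pcl.
    have : (y s + y t - y r + v) @[v --> (0 : 'rV[R]_d)] --> y s + y t - y r + 0.
      apply: (@cvgD _ _ _ _ (nbhs_filter (0 : 'rV[R]_d))); first exact: cvg_cst.
      exact: cvg_id.
    by rewrite addr0; move/(_ _ (open_nbhs_nbhs (conj oP nP))).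
  by exists e => // v ve; apply: H => i; rewrite mxE subr0.
set c := p - y s; set f := y t - y s.
have [b b0 cfb] : exists2 b : R, 0 < b & forall i, `|c 0 i| <= b /\ `|f 0 i| <= b.
  exists (1 + (\sum_i `|c 0 i| + \sum_i `|f 0 i|)).
    by rewrite ltr_wpDr// addr_ge0// sumr_ge0.
  move=> i; have le (a : 'rV[R]_d) : 0 <= \sum_j `|a 0 j| by rewrite sumr_ge0.
  have lei (a : 'rV[R]_d) : `|a 0 i| <= \sum_j `|a 0 j|.
    by rewrite (bigD1 i)//= lerDl sumr_ge0.
  have := le c; have := le f; have := lei c; have := lei f.
  by split; lra.
(* Ensures 2h(|c_i| + 2|f_i|) <= 6hb < e, which keeps the test points in that neighbourhood, and h
   <= 1/8, which keeps the weight [m] below in [0, 1]. *)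
pose h := e / (8 * (b + e)).
have h0 : 0 < h by rewrite divr_gt0// mulr_gt0// addr_gt0.
have h8 : h * (8 * b) < e.
  rewrite /h mulrAC ltr_pdivrMr ?mulr_gt0// ?addr_gt0//.
  by rewrite ltr_pM2l// ltr_pM2l// ltrDl.
have h1 : h <= 1 / 8.
  rewrite /h ler_pdivrMr ?mulr_gt0// ?addr_gt0// mulrA mulfVK// ?mul1r ?lerDr ?ltW//.
have /andP[g0 g1] := uP p Pp; set g := lf u (p - y s) in g0 g1 *.
(* The test point is the edge midpoint moved by h(c - l f). Relative to [y s], its preimage under
   the tile map of [t] has u-value 1 + 2h(g - l) <= 1, under that of [s] it has 2h(g - l) >= 0. *)
have tile l : -1 <= l <= 2 ->
    P (y t + (2 * h) *: (c - l *: f)) /\ g <= l \/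
    P (y s + (2 * h) *: (c - l *: f)) /\ l <= g.
  move=> /andP[l1 l2].
  have lfv : lf u (c - l *: f) = g - l by rewrite lfB lfZ u1 mulr1.
  pose q := y s + 2^-1 *: f + h *: (c - l *: f).
  have Pq : P q.
    pose m := (1/2 - h * l) / (1 - h).
    have h1' : 1 - h != 0 by rewrite subr_eq0; apply/eqP; lra.
    have m01 : 0 <= m <= 1.
      rewrite /m divr_ge0/=; [|by nra|by nra].
      by rewrite ler_pdivrMr; nra.
    have -> : q = (1 - h) *: ((1 - m) *: y s + m *: y t) + h *: p.
      apply/rowP => i; rewrite /q /c /f /m !mxE; field.
      exact: h1'.
    apply: hull_convex Pp; first by lra.
    by apply: hull_convex; [|exact: hull_point|exact: hull_point].
  have [r Pr] := coverP Pq.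
  have qE : 2 *: q - y r = y s + y t - y r + (2 * h) *: (c - l *: f).
    by apply/rowP => i; rewrite /q /f !mxE; field.
  have [rs|rt] : r = s \/ r = t.
    apply: (eP ((2 * h) *: (c - l *: f))); last by rewrite -qE.
    move=> i; have [ci fi] := cfb i.
    have li : `|l| <= 2 by rewrite ler_norml; lra.
    have lfi := ler_pM (normr_ge0 _) (normr_ge0 _) li fi.
    have cl : `|(c - l *: f) 0 i| <= b + 2 * b.
      rewrite !mxE; apply: le_trans (ler_normB _ _) _; rewrite normrM.
      by apply: lerD; [have := ci; rewrite !mxE|have := lfi; rewrite !mxE].
    have h20 : 0 < 2 * h by lra.
    rewrite mxE normrM (gtr0_norm h20).
    move: cl; set z := `|_|; nra.
  - left; have Pr' : P (y t + (2 * h) *: (c - l *: f)).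
      by move: Pr; rewrite qE rs [y s + y t]addrC addrK.
    split=> //; have /andP[_] := uP _ Pr'.
    rewrite addrAC lfD u1 lfZ lfv; nra.
  - right; have Pr' : P (y s + (2 * h) *: (c - l *: f)).
      by move: Pr; rewrite qE rt addrK.
    split=> //; have /andP[+ _] := uP _ Pr'.
    rewrite addrAC subrr add0r lfZ lfv; nra.
exists (2 * h); first by rewrite mulr_gt0.
have shift z (k : R) :
    z + (2 * h) *: (c - g *: f) + k *: - ((2 * h) *: f) = z + (2 * h) *: (c - (g + k) *: f).
  by apply/rowP => i; rewrite !mxE; ring.
(* For l = g the tile is undecided. Letting l tend to g from below gives the claim at [y s], from
   above at [y t], as [P] is closed. *)
split.
- apply: (closed_ray (v := (2 * h) *: f) Pcl) => k /andP[k0 k1].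
  rewrite (_ : k *: _ = (- k) *: - ((2 * h) *: f)); last by rewrite scalerN scaleNr opprK.
  rewrite shift.
  have [|[_ ?]|[]//] := tile (g - k); last by lra.
  by apply/andP; split; lra.
- apply: (closed_ray (v := - ((2 * h) *: f)) Pcl) => k /andP[k0 k1].
  rewrite shift; have [|[]//|[_ ?]] := tile (g + k); last by lra.
  by apply/andP; split; lra.
Qed.

Variable a0 : T.

Let e t : 'rV[R]_d := y t - y a0.

Definition cone_at (S : {set T}) : set 'rV[R]_d :=
  [set c | exists a : T -> R, (forall t, 0 <= a t) /\ c = \sum_(t in S) a t *: e t].

Lemma cone_at_sum (S : {set T}) (I : finType) (A : pred I) (b : I -> R) (c : I -> 'rV[R]_d) :
  (forall i, A i -> 0 <= b i) -> (forall i, A i -> cone_at S (c i)) ->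
  cone_at S (\sum_(i | A i) b i *: c i).
Proof.
move=> b0 Sc; apply: (big_ind (cone_at S)).
- by exists (fun=> 0); split=> //; rewrite big1// => t _; rewrite scale0r.
- move=> _ _ [a [a_ge0 ->]] [a' [a'_ge0 ->]]; exists (fun t => a t + a' t); split.
    by move=> t; rewrite addr_ge0.
  by rewrite -big_split/=; apply: eq_bigr => t _; rewrite scalerDl.
- move=> i Ai; have [a [a_ge0 ->]] := Sc i Ai; exists (fun t => b i * a t); split.
    by move=> t; rewrite mulr_ge0// b0.
  by rewrite scaler_sumr; apply: eq_bigr => t _; rewrite scalerA.
Qed.

Section Basis.
Variables (S : {set T}) (phi : T -> 'cV[R]_d).
Hypothesis S_gen : forall t, cone_at S (e t).
Hypothesis S_min : forall S' : {set T}, (forall t, cone_at S' (e t)) -> (#|S| <= #|S'|)%N.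
Hypothesis phiP : forall t, t != a0 -> normalized a0 t (phi t).

Lemma cone_hull p : P p -> cone_at S (p - y a0).
Proof.
move=> [a [a_ge0 a1 ->]].
have -> : \sum_t a t *: y t - y a0 = \sum_t a t *: e t.
  rewrite -[y a0 in LHS]scale1r -a1 scaler_suml -sumrB.
  by apply: eq_bigr => t _; rewrite scalerBr.
by apply: cone_at_sum => t _.
Qed.

Lemma S_minD1 j : j \in S -> ~ cone_at (S :\ j) (e j).
Proof.
move=> jS Sj; suff : (#|S| <= #|S :\ j|)%N by rewrite (cardsD1 j S) jS ltnn.
apply: S_min => t; have [a [a_ge0 ->]] := S_gen t.
apply: cone_at_sum => [i _|i iS]; first exact: a_ge0.
have [->//|ij] := eqVneq i j.
exists (fun t => (t == i)%:R); split=> [s|]; first by rewrite ler0n.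
rewrite (bigD1 i)/= ?inE ?ij// eqxx scale1r big1 ?addr0// => s /andP[_ /negbTE ->].
by rewrite scale0r.
Qed.

Lemma a0_notin : a0 \notin S.
Proof.
apply/negP => /S_minD1; apply; exists (fun=> 0); split=> //.
by rewrite /e subrr big1// => t _; rewrite scale0r.
Qed.

Lemma S_neq j : j \in S -> j != a0.
Proof. by apply: contraTneq => ->; exact: a0_notin. Qed.

Lemma phi_bound t p : t != a0 -> P p -> 0 <= lf (phi t) (p - y a0) <= 1.
Proof. by move=> /phiP[_]; apply. Qed.

Lemma phi_e t : t != a0 -> lf (phi t) (e t) = 1.
Proof. by move=> /phiP[]. Qed.

(** A coefficient of e_j below 1 would express e_j by the other generators, against minimality. So
    subtracting e_j leaves a nonnegative combination equal to 0, and a functional positive on all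
    generators makes it trivial. *)
Lemma cone_coef j (a : T -> R) : j \in S -> (forall t, 0 <= a t) ->
  e j = \sum_(t in S) a t *: e t -> forall t, t \in S -> a t = (t == j)%:R.
Proof.
move=> jS a_ge0 ej.
have aj : 1 <= a j.
  rewrite leNgt; apply/negP => aj1; apply: (S_minD1 jS).
  have nz : 1 - a j != 0 by rewrite subr_eq0 gt_eqF.
  exists (fun t => a t / (1 - a j)); split=> [t|].
    by rewrite divr_ge0// subr_ge0 ltW.
  have ej' : (1 - a j) *: e j = \sum_(t in S :\ j) a t *: e t.
    rewrite scalerBl scale1r [X in X - _]ej (bigD1 j)//= addrAC subrr add0r.
    by apply: eq_bigl => t; rewrite !inE andbC.
  apply: (scalerI nz); rewrite ej' scaler_sumr; apply: eq_bigr => t _.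
  by rewrite scalerA mulrC divfK.
pose H := \sum_(t | t != a0) phi t.
have lfH p : lf H p = \sum_(t | t != a0) lf (phi t) p.
  by rewrite /lf mulmx_sumr summxE.
have H1 t : t != a0 -> 1 <= lf H (e t).
  move=> ta; rewrite lfH (bigD1 t)//= (phi_e ta) lerDl.
  apply: sumr_ge0 => s /andP[sa _].
  by have /andP[] := phi_bound sa (hull_point y t).
have z : \sum_(t in S) (a t - (t == j)%:R) * lf H (e t) = 0.
  under eq_bigr do rewrite mulrBl -!lfZ -lfB.
  rewrite -lf_sum sumrB -ej (bigD1 j)//= eqxx scale1r big1 ?addr0 ?subrr ?lf0//.
  by move=> t /andP[_ /negbTE ->]; rewrite scale0r.
move=> t tS; apply/eqP; rewrite -subr_eq0.
have H0 s : s \in S -> 0 < lf H (e s).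
  by move=> /S_neq/H1; apply: lt_le_trans.
have ge s : s \in S -> 0 <= (a s - (s == j)%:R) * lf H (e s).
  move=> sS; apply: mulr_ge0; last by rewrite ltW// H0.
  by rewrite subr_ge0; case: eqVneq => [->|_].
have := psumr_eq0P ge z tS.
by move/eqP; rewrite mulf_eq0 (gt_eqF (H0 t tS)) orbF.
Qed.

(** [y r] and its reflection in the midpoint of [y_a0, y_j] give two vectors of the cone with sum
    e_j. Uniqueness makes e_r a multiple of e_j, and for r != a0 the functional [phi r] forces the
    factor 1. *)
Lemma generator_edge j r : j \in S -> P (y a0 + y j - y r) -> r = a0 \/ r = j.
Proof.
move=> jS /cone_hull[b [b_ge0 bE]]; have [a [a_ge0 aE]] := S_gen r.
have ej : e j = \sum_(t in S) (a t + b t) *: e t.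
  under eq_bigr do rewrite scalerDl.
  by rewrite big_split/= -aE -bE /e; apply/rowP => i; rewrite !mxE; ring.
have ab := cone_coef jS (fun t => addr_ge0 (a_ge0 t) (b_ge0 t)) ej.
have er : e r = a j *: e j.
  rewrite aE (bigD1 j)//= big1 ?addr0// => t /andP[tS /negbTE tj].
  have := ab t tS; rewrite tj => /eqP; rewrite paddr_eq0// => /andP[/eqP -> _].
  by rewrite scale0r.
have [->|ra] := eqVneq r a0; [by left|right].
have aj1 : a j <= 1 by have := ab j jS; rewrite eqxx mulr1n; have := b_ge0 j; lra.
have := phi_e ra; rewrite er lfZ => E.
have /andP[f0 f1] := phi_bound ra (hull_point y j).
have aj : a j = 1 by have := a_ge0 j; rewrite /e in E; nra.
move: er; rewrite aj scale1r => /addIr; exact: pairwise_antipodal_inj.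
Qed.

(** For i != j, [edge_split] puts a positive multiple of e_i - g e_j in the cone, where g =
    phi_j(e_i). Then e_i has a representation with coefficient at least g at e_j, so g = 0 by
    uniqueness. *)
Lemma phi_dual i j : i \in S -> j \in S -> lf (phi j) (e i) = (i == j)%:R.
Proof.
move=> iS jS; have [->|ij] := eqVneq i j; first by rewrite phi_e// S_neq.
have [h h0 [H _]] := edge_split (phiP (S_neq jS)) (fun r => @generator_edge j r jS)
  (hull_point y i).
have [b [b_ge0]] := cone_hull H.
rewrite addrAC subrr add0r -/(e i) -/(e j); set g := lf _ _ => E.
have g0 : 0 <= g by have /andP[] := phi_bound (S_neq jS) (hull_point y i).
have ei : e i = \sum_(t in S) (b t / h + (t == j)%:R * g) *: e t.
  under eq_bigr do rewrite scalerDl.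
  rewrite big_split/= [X in _ + X](bigD1 j)//= eqxx mul1r.
  rewrite [X in _ + (_ + X)]big1 ?addr0; last first.
    by move=> t /andP[_ /negbTE ->]; rewrite mul0r scale0r.
  have -> : \sum_(t in S) (b t / h) *: e t = h^-1 *: \sum_(t in S) b t *: e t.
    by rewrite scaler_sumr; apply: eq_bigr => t _; rewrite scalerA mulrC.
  by rewrite -E scalerA mulVf ?gt_eqF// scale1r subrK.
have c_ge0 t : 0 <= b t / h + (t == j)%:R * g.
  apply: addr_ge0; first by apply: divr_ge0 => //; exact: ltW.
  by apply: mulr_ge0 => //; exact: ler0n.
have := cone_coef iS c_ge0 ei jS; rewrite eqxx eq_sym (negbTE ij) mul1r => /eqP.
by rewrite paddr_eq0// ?divr_ge0 ?(ltW h0)// => /andP[_ /eqP].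
Qed.

Lemma phi_sum (a : T -> R) j : j \in S -> lf (phi j) (\sum_(t in S) a t *: e t) = a j.
Proof.
move=> jS; rewrite lf_sum (bigD1 j)//= lfZ phi_dual// eqxx mulr1 big1 ?addr0//.
by move=> t /andP[tS /negbTE tj]; rewrite lfZ phi_dual// tj mulr0.
Qed.

Lemma phi_coord p : P p -> p = y a0 + \sum_(t in S) lf (phi t) (p - y a0) *: e t.
Proof.
move=> /cone_hull[a [_ aE]]; rewrite -[LHS](subrKC (y a0)) [in LHS]aE.
congr (_ + _); apply: eq_bigr => t tS; congr (_ *: _).
by rewrite aE phi_sum.
Qed.

Definition corner (B : {set T}) : 'rV[R]_d := y a0 + \sum_(t in B) e t.

Lemma corner_coord (B : {set T}) : B \subset S ->
  corner B = y a0 + \sum_(t in S) (t \in B)%:R *: e t.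
Proof.
move=> /fintype.subsetP BS; congr (_ + _).
rewrite [RHS](eq_bigr (fun t => if t \in B then e t else 0)); last first.
  by move=> t _; case: ifP => _; rewrite ?scale1r ?scale0r.
rewrite -big_mkcondr; apply: eq_bigl => t.
by case: (boolP (t \in B)) => [/BS ->|_]; rewrite ?andbF.
Qed.

Lemma phi_corner (B : {set T}) j : B \subset S -> j \in S ->
  lf (phi j) (corner B - y a0) = (j \in B)%:R.
Proof.
by move=> BS jS; rewrite corner_coord// addrAC subrr add0r (phi_sum (fun t => (t \in B)%:R)).
Qed.

Lemma weighted_extreme (a f : T -> R) (b : bool) : (forall t, 0 <= a t) ->
  \sum_t a t = 1 -> (forall t, 0 <= f t <= 1) -> \sum_t a t * f t = b%:R ->
  forall t, 0 < a t -> f t = b%:R.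
Proof.
move=> a_ge0 a1 f01 afb t at0.
have [g g_ge0 gE] : exists2 g : T -> R, forall s, 0 <= g s &
    \sum_s a s * g s = 0 /\ (g t = 0 -> f t = b%:R).
  case: b afb => [af1|af0].
    exists (fun s => 1 - f s) => [s|]; first by have := f01 s; lra.
    split; last by move=> ft; rewrite mulr1n; lra.
    under eq_bigr do rewrite mulrBr mulr1.
    by rewrite sumrB a1 af1 mulr1n subrr.
  by exists f => // s; have /andP[] := f01 s.
case: gE => gE; apply; apply/eqP.
have := psumr_eq0P (fun s _ => mulr_ge0 (a_ge0 s) (g_ge0 s)) gE (isT : xpredT t).
by move/eqP; rewrite mulf_eq0 (gt_eqF at0).
Qed.

(** Induction on |B|: a corner is reached along e_j from the corner without [j]. The second
    conclusion keeps the induction running, as it supplies the directions into the parallelotope at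
    the new corner. *)
Lemma corner_vertex (B : {set T}) : B \subset S ->
  exists2 t, y t = corner B &
    forall i, i \in S -> exists2 h : R, 0 < h &
      P (y t + (if i \in B then - h else h) *: e i).
Proof.
move: {2}#|B| (erefl #|B|) => m; elim: m B => [|m IH] B.
  move=> /eqP; rewrite cards_eq0 => /eqP -> _; exists a0.
    by rewrite /corner big_set0 addr0.
  move=> i iS; exists 1 => //; rewrite inE scale1r /e subrKC; exact: hull_point.
move=> Bm BS; have [j jB] : exists j, j \in B by apply/card_gt0P; rewrite Bm.
have jS := fintype.subsetP BS j jB; have ja := S_neq jS.
pose B' := B :\ j.
have B'S : B' \subset S by apply: fintype.subset_trans (subD1set _ _) BS.
have B'm : #|B'| = m by apply/eqP; rewrite -eqSS -Bm [in eqbRHS](cardsD1 j B) jB.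
have [s ys rays] := IH B' B'm B'S.
have jB' : j \notin B' by rewrite !inE eqxx.
have cB : corner B = y s + e j.
  by rewrite ys /corner (big_setD1 j jB)/= addrA addrAC.
have phis i : i \in S -> lf (phi i) (y s - y a0) = (i \in B')%:R.
  by move=> iS; rewrite ys phi_corner.
(* A point of P agreeing with y s in every coordinate but the j-th. *)
have line r : (forall i, i \in S -> i != j -> lf (phi i) (y r - y a0) = (i \in B')%:R) ->
    y r = y s + lf (phi j) (y r - y a0) *: e j.
  move=> H; rewrite [LHS](phi_coord (hull_point y r)) [in RHS](phi_coord (hull_point y s)).
  rewrite -addrA; congr (_ + _); rewrite !(bigD1 j jS)/= phis// (negbTE jB') scale0r add0r.
  rewrite [RHS]addrC; congr (_ + _); apply: eq_bigr => i /andP[iS ij].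
  by rewrite H// phis.
(* The chord [y_a0, y_j] is parallel to [y_s, y_r] and cannot be longer. *)
have diam r c : y r = y s + c *: e j -> r != s -> 0 < c -> 1 <= c.
  move=> yr rs c0.
  have : c^-1 <= 1.
    apply: (@affine_diameter s r (y a0)); first by rewrite eq_sym.
      exact: hull_point.
    rewrite yr addrAC subrr add0r scalerA mulVf ?gt_eqF// scale1r subrKC.
    exact: hull_point.
  by rewrite invf_le1.
(* A point of the ray along e_j is a convex combination of the [y t]. Its other coordinates have the
   extreme values 0 or 1, so all terms of positive weight lie on the line, and one of them lies
   beyond [y s]. *)
have [t yt] : exists t, y t = corner B.
  have [h h0] := rays j jS; rewrite (negbTE jB') => -[a [a_ge0 a1 aE]].
  have coord i : lf (phi i) (y s + h *: e j - y a0) =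
      \sum_t a t * lf (phi i) (y t - y a0).
    rewrite lfB aE lf_sum; under eq_bigr do rewrite lfZ.
    under [RHS]eq_bigr do rewrite lfB mulrBr.
    by rewrite sumrB -mulr_suml a1 mul1r.
  have [t [at0 ft0]] : exists t, 0 < a t /\ lf (phi j) (y t - y a0) > 0.
    apply: contrapT => H.
    have : \sum_t a t * lf (phi j) (y t - y a0) <= 0.
      apply: sumr_le0 => t _.
      have /andP[f0 _] := phi_bound ja (hull_point y t).
      have [at0|] := ltP 0 (a t); last first.
        by move=> ?; rewrite mulr_le0_ge0.
      have [ft|] := ltP 0 (lf (phi j) (y t - y a0)); last by move=> ?; rewrite mulr_ge0_le0.
      by exfalso; apply: H; exists t.
    rewrite -coord addrAC lfD phis// (negbTE jB') add0r lfZ phi_e// mulr1.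
    by rewrite leNgt h0.
  have yt : y t = y s + lf (phi j) (y t - y a0) *: e j.
    apply: line => i iS ij.
    apply: (@weighted_extreme a (fun t => lf (phi i) (y t - y a0))) at0 => //.
      by move=> r; apply: phi_bound (hull_point y r); exact: S_neq.
    by rewrite -coord addrAC lfD phis// lfZ phi_dual// eq_sym (negbTE ij) mulr0 addr0.
  exists t; rewrite cB yt; congr (_ + _).
  have ts : t != s.
    apply/eqP => ts; move: ft0; rewrite ts phis// (negbTE jB').
    by rewrite ltxx.
  have /andP[_ f1] := phi_bound ja (hull_point y t).
  have f1' := diam t _ yt ts ft0.
  by rewrite [lf _ _](_ : _ = 1) ?scale1r//; apply/eqP; rewrite eq_le f1 f1'.
exists t => // i iS.
have [->|ij] := eqVneq i j.
  by exists 1 => //; rewrite jB yt cB scaleN1r addrK; exact: hull_point.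
have -> : (i \in B) = (i \in B') by rewrite !inE ij.
have [h h0 Ph] := rays i iS.
have norm_st : normalized s t (phi j).
  split; first by rewrite yt cB addrAC subrr add0r phi_e.
  move=> p Pp; rewrite lfB; have := phi_bound ja Pp.
  have := phis j jS; rewrite (negbTE jB') !lfB mulr0n => /eqP; rewrite subr_eq0 => /eqP ->.
  by [].
(* In a coordinate other than [j], [y r] and its reflection have values in [0, 1] with sum 0 or 2,
   so [y r] agrees with [y s] there. *)
have edge r : P (y s + y t - y r) -> r = s \/ r = t.
  move=> Pr; have yr : y r = y s + lf (phi j) (y r - y a0) *: e j.
    apply: line => i' i'S i'j.
    have := phi_bound (S_neq i'S) Pr; have := phi_bound (S_neq i'S) (hull_point y r).
    have -> : y s + y t - y r - y a0 = (y s - y a0) + (y s - y a0) + e j - (y r - y a0).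
      by rewrite yt cB; apply/rowP => l; rewrite !mxE; ring.
    have := phi_dual jS i'S; rewrite eq_sym (negbTE i'j) => phie.
    move: (y s - y a0) (y r - y a0) (phis i' i'S) => a b pa.
    move: (e j) phie => v phie.
    rewrite lfB !lfD pa phie.
    by case: (i' \in B') => /=; rewrite ?mulr1n ?mulr0n; lra.
  have [->|rs] := eqVneq r s; [by left|right].
  have /andP[f0 f1] := phi_bound ja (hull_point y r).
  have f0' : 0 < lf (phi j) (y r - y a0).
    rewrite lt_def f0 andbT; apply: contraNneq rs => fz.
    by apply/eqP/pairwise_antipodal_inj; rewrite yr fz scale0r addr0.
  have f1' := diam r _ yr rs f0'.
  apply: pairwise_antipodal_inj; rewrite yr yt cB.
  by rewrite [lf _ _](_ : _ = 1) ?scale1r//; apply/eqP; rewrite eq_le f1 f1'.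
(* Since phi_j(e_i) = 0, the direction e_i is carried from [y s] to [y t] unchanged. *)
have [h' h'0 [_]] := edge_split norm_st edge Ph.
set v := (if _ then _ else _) *: e i; have -> : y s + v - y s = v.
  by rewrite addrAC subrr add0r.
rewrite /v lfZ phi_dual// (negbTE ij) mulr0 scale0r subr0.
rewrite scalerA => Ph'; exists (h' * h); first by rewrite mulr_gt0.
by move: Ph'; case: ifP; rewrite ?mulrN.
Qed.

Lemma corner_hull (B : {set T}) : B \subset S -> P (corner B).
Proof. by move=> /corner_vertex[t <- _]; exact: hull_point. Qed.

(* Rounding the coordinates one at a time: C collects those not yet rounded. *)
Lemma box_hull (a : T -> R) : (forall j, j \in S -> 0 <= a j <= 1) ->
  P (y a0 + \sum_(j in S) a j *: e j).
Proof.
move=> a01.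
suff H (C B : {set T}) : C \subset S -> B \subset S -> (forall i, i \in C -> i \notin B) ->
    P (y a0 + \sum_(j in B) e j + \sum_(j in C) a j *: e j).
  have := H S finset.set0 (fintype.subxx S) (finset.sub0set S).
  by rewrite big_set0 addr0; apply=> i _; rewrite inE.
move: {2}#|C| (erefl #|C|) => m; elim: m C B => [|m IH] C B.
  move=> /eqP; rewrite cards_eq0 => /eqP -> _ BS _.
  by rewrite big_set0 addr0; exact: corner_hull.
move=> Cm CS BS CB; have [j jC] : exists j, j \in C by apply/card_gt0P; rewrite Cm.
have jS := fintype.subsetP CS j jC.
have C'm : #|C :\ j| = m by apply/eqP; rewrite -eqSS -Cm [in eqbRHS](cardsD1 j C) jC.
have C'S : C :\ j \subset S by apply: fintype.subset_trans (subD1set _ _) CS.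
have C'B i : i \in C :\ j -> i \notin B by rewrite !inE => /andP[_]; exact: CB.
have jB := CB j jC.
have P0 := IH _ B C'm C'S BS C'B.
have P1 : P (y a0 + \sum_(i in j |: B) e i + \sum_(i in C :\ j) a i *: e i).
  apply: IH => //; first by rewrite finset.subUset finset.sub1set jS.
  move=> i iC; rewrite in_setU1 negb_or C'B// andbT.
  by move: iC; rewrite !inE => /andP[].
have := hull_convex (a01 j jS) P0 P1.
rewrite big_setU1//= (big_setD1 j jC)/=.
set X := \sum_(i in B) _; set Y := \sum_(i in _) _.
by congr P; apply/rowP => l; rewrite !mxE; ring.
Qed.

(** A functional that is maximal at [y t] and smaller at [y s] leaves no weight for [y s]. *)
Lemma antipodal_extreme (a : T -> R) t : (forall s, 0 <= a s) -> \sum_s a s = 1 ->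
  y t = \sum_s a s *: y s -> forall s, s != t -> a s = 0.
Proof.
move=> a_ge0 a1 yt s st; have [u [u1 uP]] := normalized_functional st.
have u0 : \sum_r a r * (1 - lf u (y r - y s)) = 0.
  under eq_bigr do rewrite mulrBr mulr1 lfB mulrBr.
  rewrite sumrB a1 sumrB -mulr_suml a1 mul1r -[X in _ - (X - _)](_ : lf u (y t) = _).
    by rewrite -lfB u1 subrr.
  by rewrite yt lf_sum; apply: eq_bigr => r _; rewrite lfZ.
have ge r : 0 <= a r * (1 - lf u (y r - y s)).
  by rewrite mulr_ge0// subr_ge0; have /andP[] := uP _ (hull_point y r).
have := psumr_eq0P (fun r _ => ge r) u0 (isT : xpredT s).
by move=> /(_ s); rewrite subrr lf0 subr0 mulr1.
Qed.

Lemma extreme_vertex t p q c : 0 < c < 1 -> P p -> P q ->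
  y t = (1 - c) *: p + c *: q -> p = y t /\ q = y t.
Proof.
move=> /andP[c0 c1] [a [a_ge0 a1 ->]] [b [b_ge0 b1 ->]] yt.
have c1' : 0 < 1 - c by rewrite subr_gt0.
have ab_ge0 s : 0 <= (1 - c) * a s + c * b s.
  by rewrite addr_ge0// mulr_ge0// ltW.
have ab0 s : s != t -> a s = 0 /\ b s = 0.
  move=> st; have := antipodal_extreme ab_ge0 _ _ st.
  have -> : \sum_s ((1 - c) * a s + c * b s) = 1.
    by rewrite big_split/= -!mulr_sumr a1 b1; ring.
  have -> : \sum_s ((1 - c) * a s + c * b s) *: y s = y t.
    under eq_bigr do rewrite scalerDl -!scalerA.
    by rewrite big_split/= -!scaler_sumr yt.
  move=> /(_ erefl erefl)/eqP; rewrite paddr_eq0 ?mulr_ge0 ?(ltW c0) ?(ltW c1')//.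
  by rewrite !mulf_eq0 (gt_eqF c0) (gt_eqF c1') /= => /andP[/eqP -> /eqP ->].
have single (w : T -> R) : \sum_s w s = 1 -> (forall s, s != t -> w s = 0) ->
    \sum_s w s *: y s = y t.
  move=> w1 w0; have wt : w t = 1.
    by move: w1; rewrite (bigD1 t)//= big1 ?addr0.
  by rewrite (bigD1 t)//= wt scale1r big1 ?addr0// => s /w0 ->; rewrite scale0r.
by split; apply: single => // s /ab0[].
Qed.

(** A coordinate strictly between 0 and 1 would place [y t] inside a segment of the box parallel to
    e_j, against extremality. *)
Lemma vertex_corner t : exists2 B : {set T}, B \subset S & y t = corner B.
Proof.
pose c j := lf (phi j) (y t - y a0).
have c01 j : j \in S -> 0 <= c j <= 1.
  by move=> /S_neq ja; apply: phi_bound (hull_point y t).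
have cS j : j \in S -> c j = 0 \/ c j = 1.
  move=> jS; have /andP[cj0 cj1] := c01 j jS.
  have [|cn0] := eqVneq (c j) 0; first by left.
  have [|cn1] := eqVneq (c j) 1; first by right.
  have c01' : 0 < c j < 1 by rewrite !lt_def cn0 cj0 eq_sym cn1.
  pose z (b : R) := y a0 + \sum_(i in S) (if i == j then b else c i) *: e i.
  have zP b : 0 <= b <= 1 -> P (z b).
    by move=> b01; apply: box_hull => i iS; case: ifP => // _; exact: c01.
  have z0 : P (z 0) by apply: zP; rewrite lexx ler01.
  have z1 : P (z 1) by apply: zP; rewrite lexx ler01.
  have [|zt _] := @extreme_vertex t _ _ _ c01' z0 z1.
    have zE b : z b = y a0 + (b *: e j + \sum_(i in S | i != j) c i *: e i).
      rewrite /z (bigD1 j jS)/= eqxx; congr (_ + (_ + _)).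
      by apply: eq_bigr => i /andP[_ /negbTE ->].
    rewrite !zE [LHS](phi_coord (hull_point y t)) (bigD1 j jS)/= -/(c j).
    by set X := \sum_(_ in S | _) _; apply/rowP => l; rewrite !mxE; ring.
  left; rewrite /c -zt /z addrAC subrr add0r phi_sum// eqxx.
  by [].
exists [set j in S | c j == 1]; first by apply/fintype.subsetP => j; rewrite inE => /andP[].
rewrite corner_coord; last by apply/fintype.subsetP => j; rewrite inE => /andP[].
rewrite [LHS](phi_coord (hull_point y t)); congr (_ + _); apply: eq_bigr => j jS.
rewrite inE jS -/(c j); case: (cS j jS) => ->; rewrite ?eqxx//=.
by rewrite eq_sym oner_eq0.
Qed.

Lemma card_corners : #|T| = (2 ^ #|S|)%N.
Proof.
rewrite -card_powerset.
have corner_inj : {in powerset S &, injective corner}.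
  move=> A B; rewrite !inE => AS BS AB; apply/setP => j.
  have [jS|jS] := boolP (j \in S).
    have := phi_corner AS jS; rewrite AB phi_corner// => /eqP.
    by rewrite eqr_nat; case: (j \in A); case: (j \in B).
  have out (C : {set T}) : C \subset S -> (j \in C) = false.
    by move=> CS; apply: contraNF jS; exact: (fintype.subsetP CS).
  by rewrite !out.
have [f fP] := @choice T {set T} (fun t B => B \subset S /\ y t = corner B)
  (fun t => let: ex_intro2 B BS yt := vertex_corner t in ex_intro _ B (conj BS yt)).
have f_inj : injective f.
  by move=> s t fst; apply: pairwise_antipodal_inj; rewrite (fP s).2 (fP t).2 fst.
rewrite -cardsT -(card_imset [set: T]%SET f_inj).
apply: eq_card => B; apply/imsetP/idP => [[t _ ->]|].
  by rewrite inE; exact: (fP t).1.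
rewrite inE => BS; have [t yt _] := corner_vertex BS; exists t => //.
apply: corner_inj; rewrite ?inE// ?(fP t).1//.
by rewrite -(fP t).2 yt.
Qed.

End Basis.

Theorem cube_structure : exists (S : {set T}) (phi : T -> 'cV[R]_d),
  [/\ #|T| = (2 ^ #|S|)%N,
      forall i j, i \in S -> j \in S -> lf (phi j) (y i - y a0) = (i == j)%:R,
      forall p, P p <-> exists a : T -> R, (forall j, j \in S -> 0 <= a j <= 1) /\
        p = y a0 + \sum_(j in S) a j *: (y j - y a0) &
      forall B : {set T}, B \subset S ->
        exists t, y t = y a0 + \sum_(j in B) (y j - y a0)].
Proof.
have [|phi phiP] := @choice T 'cV[R]_d (fun t u => t != a0 -> normalized a0 t u).
  move=> t; have [->|ta] := eqVneq t a0; first by exists 0.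
  by have [|u Hu] := @normalized_functional a0 t; [rewrite eq_sym|exists u].
pose gen (S : {set T}) := `[< forall t, cone_at S (e t) >].
have genT : gen [set: T]%SET.
  apply/asboolP => t; exists (fun s => (s == t)%:R); split=> [s|]; first by rewrite ler0n.
  rewrite (bigD1 t)/= ?inE// eqxx scale1r big1 ?addr0// => s /andP[_ /negbTE ->].
  by rewrite scale0r.
case: (@arg_minnP _ _ gen (fun S => #|S|) genT) => S /asboolP S_gen S_min'.
have S_min (S' : {set T}) : (forall t, cone_at S' (e t)) -> (#|S| <= #|S'|)%N.
  by move=> S'g; apply: S_min'; apply/asboolP.
exists S, phi; split=> [|i j iS jS|p|B BS].
- exact: card_corners S_gen S_min phiP.
- exact: phi_dual.
- split=> [Pp|[a [a01 ->]]]; last exact: box_hull S_gen S_min phiP _ a01.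
  exists (fun j => lf (phi j) (p - y a0)); split; last exact: phi_coord S_gen S_min phiP _ Pp.
  move=> j jS; apply: phi_bound phiP _ _ _ Pp.
  exact: S_neq S_gen S_min _ jS.
- by have [t yt _] := corner_vertex S_gen S_min phiP BS; exists t.
Qed.

End Cube.

(** * Configurations attaining the cardinality bound *)

Section Extremal.
Variables (R : realType) (d n k' : nat) (x : 'I_n -> 'rV[R]_d).
Variable related : 'rV[R]_d -> 'rV[R]_d -> Prop.
Hypothesis nE : n = (k' * 2 ^ d)%N.
Hypothesis k'_gt0 : (0 < k')%N.
Hypothesis related_irr : forall p, ~ related p p.
Hypothesis related_sym : forall p q, related p q -> related q p.
Hypothesis related_antipodal : forall i j, related (x i) (x j) -> antipodal x i j.
Hypothesis relatedP : forall A : {set 'I_n}, (k' < #|A|)%N ->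
  exists a b, [/\ a \in A, b \in A & related (x a) (x b)].

Lemma lf_delta i (p : 'rV[R]_d) : lf (delta_mx i 0) p = p 0 i.
Proof.
rewrite lfE (bigD1 i)//= mxE !eqxx mulr1 big1 ?addr0// => j /negbTE ji.
by rewrite mxE ji mulr0.
Qed.

(** As its tiles cover it, the slab polytope is conv X itself by [hull_cover], so [slabs_cover]
    becomes a statement on the hull. *)
Lemma extremal_cover p : hull x p -> (k' <= #|[pred i | `[< hull x (2 *: p - x i)%R >]]|)%N.
Proof.
have [w wP] := separating_functionals x.
have kP (A : {set 'I_n}) : (k' < #|A|)%N ->
    exists a b, [/\ a \in A, b \in A & antipodal x a b].
  by move=> /relatedP[a [b [aA bA ab]]]; exists a, b; split=> //; exact: related_antipodal.
have [M M0 xM] := family_bound x.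
have PE : slabs x w M <=%R = hull x.
  apply/seteqP; split=> q.
    apply: (@hull_cover _ _ _ _ _ M) => [z []//|z Pz].
    have := slabs_cover wP M0 xM kP nE Pz => /(leq_trans k'_gt0)/card_gt0P[i].
    by rewrite inE => /asboolP/asboolP Pi; exists i.
  move=> xq; split=> [i|i j ij].
    rewrite ler_norml -lf_delta; apply/andP; split.
      by apply: hull_ge xq => l; rewrite lf_delta; have := xM l i; rewrite ltr_norml; lra.
    by apply: hull_le xq => l; rewrite lf_delta; have := xM l i; rewrite ltr_norml; lra.
  have [_ H] := wP i j ij; split.
    by apply: hull_ge xq => l; have /andP[] := H l.
  by apply: hull_le xq => l; have /andP[] := H l.
by rewrite -PE; exact: slabs_cover.
Qed.

Definition subfamily (I : {set 'I_n}) (t : 'I_#|I|) : 'rV[R]_d := x (enum_val t).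

Lemma subfamily_hull (I : {set 'I_n}) i : i \in I -> hull (subfamily (I := I)) (x i).
Proof.
move=> iI; have := hull_point (subfamily (I := I)) (enum_rank_in iI i).
by rewrite /subfamily enum_rankK_in.
Qed.

Theorem extremal_structure : exists (T : finType) (y : T -> 'rV[R]_d),
  [/\ forall p, hull y p -> exists t, hull y (2 *: p - y t),
      forall s t, s != t -> related (y s) (y t) /\ antipodal y s t,
      forall i, exists t, x i = y t,
      forall t, #|[pred i | x i == y t]| = k' &
      #|T| = (2 ^ d)%N].
Proof.
pose gen (I : {set 'I_n}) := `[< forall i, hull (subfamily (I := I)) (x i) >].
have genT : gen [set: 'I_n]%SET.
  by apply/asboolP => i; apply: subfamily_hull; rewrite inE.
case: (@arg_minnP _ _ gen (fun I => #|I|) genT) => I /asboolP Ihull I_min'.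
have I_min (J : {set 'I_n}) : (forall i, hull (subfamily (I := J)) (x i)) -> (#|I| <= #|J|)%N.
  by move=> HJ; apply: I_min'; apply/asboolP.
pose y : 'I_#|I| -> 'rV[R]_d := subfamily (I := I).
have xy : hull x `<=` hull y by apply: hull_sub => i; exact: Ihull.
have yx : hull y `<=` hull x by apply: hull_sub => t; exact: (hull_point x (enum_val t)).
(* Otherwise the other vertices would generate [y t], against the minimality of [I]. *)
have extr t (a : 'I_#|I| -> R) : (forall s, 0 <= a s) -> \sum_s a s = 1 ->
    y t = \sum_s a s *: y s -> a t = 1.
  move=> a0 a1 yt; apply: contrapT => at1.
  pose i := enum_val t; have iI : i \in I := enum_valP t.
  suff : (#|I| <= #|I :\ i|)%N by rewrite (cardsD1 i I) iI ltnn.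
  apply: I_min => j; apply: (hull_sub _ (Ihull j)) => s.
  have other r : r != t -> hull (subfamily (I := I :\ i)) (y r).
    by move=> rt; apply: subfamily_hull; rewrite !inE enum_valP andbT (inj_eq enum_val_inj).
  have [->|/other//] := eqVneq s t; rewrite -/(y t).
  have nz : 1 - a t != 0 by rewrite subr_eq0 eq_sym; apply/eqP.
  have sE : \sum_(r | r != t) a r = 1 - a t by rewrite -a1 [in RHS](bigD1 t)//= addrAC subrr add0r.
  have at1' : 0 < 1 - a t by rewrite lt_def nz -sE sumr_ge0.
  have -> : y t = \sum_(r | r != t) (a r / (1 - a t)) *: y r.
    apply: (scalerI nz); rewrite scaler_sumr.
    under eq_bigr do rewrite scalerA mulrC divfK//.
    by rewrite scalerBl scale1r [X in X - _]yt (bigD1 t)//= addrAC subrr add0r.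
  apply: hull_comb other => [r _|]; first by rewrite divr_ge0// ltW.
  by rewrite -mulr_suml sE divff.
have inj_y : injective y.
  move=> s t st; apply/eqP; apply: contraT => st'.
  have := extr t (fun r => (r == s)%:R); rewrite eq_sym (negbTE st') => H.
  suff : (0 : R) = 1 by move=> /eqP; rewrite eq_sym oner_eq0.
  apply: H => [r||]; first by rewrite ler0n.
    by rewrite (bigD1 s)//= eqxx big1 ?addr0// => r /negbTE ->.
  rewrite (bigD1 s)//= eqxx scale1r big1 ?addr0// => r /negbTE ->.
  by rewrite scale0r.
have reflect_vertex t i : hull x (2 *: y t - x i) -> x i = y t.
  move=> /xy[a [a0 a1 aE]]; have [b [b0 b1 bE]] := Ihull i.
  have ab : y t = \sum_s ((a s + b s) / 2) *: y s.
    have two : (2 : R) != 0 by [].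
    apply: (scalerI two); rewrite scaler_sumr.
    under eq_bigr do rewrite scalerA mulrC divfK// scalerDl.
    by rewrite big_split/= -aE -bE subrK.
  have abt : (a t + b t) / 2 = 1.
    apply: (extr t (fun s => (a s + b s) / 2)) ab => [s|].
      by rewrite divr_ge0// addr_ge0.
    by rewrite -mulr_suml big_split/= a1 b1 divff.
  have le1 (c : 'I_#|I| -> R) : (forall s, 0 <= c s) -> \sum_s c s = 1 -> c t <= 1.
    by move=> c0 <-; rewrite (bigD1 t)//= lerDl sumr_ge0.
  have bt : b t = 1 by have := le1 a a0 a1; have := le1 b b0 b1; lra.
  have bs s : s != t -> b s = 0.
    move=> st; have b0' : \sum_(r | r != t) b r = 0.
      by move: b1; rewrite (bigD1 t)//= bt -[RHS]addr0 => /addrI.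
    exact: (psumr_eq0P (fun r _ => b0 r) b0' st).
  by rewrite bE (bigD1 t)//= bt scale1r big1 ?addr0// => s /bs ->; rewrite scale0r.
pose fiber p : {set 'I_n} := [set i | x i == p]%SET.
(* At most [k'], as equal points are never related; at least [k'], as only tiles with x_i = y_t
   contain [y t]. *)
have fiber_card t : #|fiber (y t)| = k'.
  apply/eqP; rewrite eqn_leq; apply/andP; split.
    rewrite leqNgt; apply/negP => /relatedP[a [b []]].
    by rewrite !inE => /eqP -> /eqP -> /related_irr.
  apply: leq_trans (extremal_cover (yx _ (hull_point y t))) _.
  apply: subset_leq_card; apply/fintype.subsetP => i.
  by rewrite !inE => /asboolP/asboolP/reflect_vertex ->.
(* Adding [i] to the [k'] copies of [y t] gives enough indices for a related pair, and the copies
   alone contain none. *)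
have related_fiber t i : x i != y t -> related (y t) (x i).
  move=> it; have [|a [b []]] := relatedP (A := i |: fiber (y t)).
    by rewrite cardsU1 !inE it fiber_card.
  rewrite !inE => /orP[/eqP ->|/eqP ->] /orP[/eqP ->|/eqP ->].
  - by move=> /related_irr.
  - exact: related_sym.
  - by [].
  - by move=> /related_irr.
have x_in i : exists t, x i = y t.
  apply: contrapT => ni.
  have nit t : x i != y t by apply/eqP => it; apply: ni; exists t.
  have [a [a0 a1 aE]] := Ihull i.
  have [t at0] : exists t, 0 < a t.
    apply: contrapT => H; have : \sum_t a t <= 0.
      by apply: sumr_le0 => t _; rewrite leNgt; apply/negP => ?; apply: H; exists t.
    by rewrite a1 ler10.
  (* [u] is maximal at [x i] over the configuration, yet smaller at [y t], which has positive weight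
     in [x i]. *)
  have [u [ut uP]] := related_antipodal (related_fiber t i (nit t)).
  have z : \sum_s a s * (lf u (x i) - lf u (y s)) = 0.
    under eq_bigr do rewrite mulrBr -[a _ * lf u (y _)]lfZ.
    by rewrite sumrB -mulr_suml a1 mul1r -lf_sum -aE subrr.
  have ge s : 0 <= a s * (lf u (x i) - lf u (y s)).
    by rewrite mulr_ge0// subr_ge0; have /andP[] := uP (enum_val s).
  have := psumr_eq0P (fun s _ => ge s) z (isT : xpredT t).
  move=> /eqP; rewrite mulf_eq0 (gt_eqF at0) /= subr_eq0 => /eqP E.
  by move: ut; rewrite E ltxx.
exists 'I_#|I|, y; split=> //.
- move=> p /yx/extremal_cover/(leq_trans k'_gt0)/card_gt0P[i].
  rewrite inE => /asboolP/asboolP/xy Hi; have [t it] := x_in i.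
  by exists t; rewrite -it.
- move=> s t st; have nst : x (enum_val t) != y s.
    by rewrite -/(y t) (inj_eq inj_y) eq_sym.
  have rst := related_fiber s _ nst; split=> //.
  have [u [ut uP]] := related_antipodal rst.
  by exists u; split=> // r; exact: uP.
- by move=> t; rewrite -(fiber_card t); apply: eq_card => i; rewrite !inE.
rewrite card_ord; apply/eqP; rewrite -(eqn_pmul2l k'_gt0) -nE; apply/eqP.
transitivity (\sum_(t < #|I|) #|fiber (y t)|)%N.
  by under eq_bigr do rewrite fiber_card; rewrite sum_nat_const card_ord mulnC.
under eq_bigr do rewrite -sum1_card big_mkcond.
rewrite exchange_big /= -[RHS]card_ord -[RHS]sum1_card; apply: eq_bigr => i _.
have [t it] := x_in i; rewrite (bigD1 t)//= inE it eqxx big1// => s st.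
by rewrite inE it (inj_eq inj_y) eq_sym (negbTE st).
Qed.

End Extremal.

(** * Support functionals and gauge norms *)

Section Sublinear.
Variables (R : realType) (d : nat).
Implicit Types (f g : 'rV[R]_d -> R) (p q v : 'rV[R]_d).

Definition sublinear f : Prop :=
  (forall p q, f (p + q) <= f p + f q) /\ (forall c p, 0 < c -> f (c *: p) <= c * f p).

Lemma sublinear0 f : sublinear f -> f 0 = 0.
Proof.
move=> [_ fZ]; have := fZ 2 0 (ltr0Sn _ _); have := fZ 2^-1 0; rewrite !scaler0.
by rewrite invr_gt0 ltr0n => /(_ isT) ? ?; lra.
Qed.

Lemma sublinear_opp f p : sublinear f -> - f (- p) <= f p.
Proof. by move=> fs; have := fs.1 p (- p); rewrite subrr sublinear0//; lra. Qed.

(* The largest sublinear minorant of f that is linear on the line through q,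
   with value f q at q, is p |-> inf_(t >= 0) (f (p + t q) - t f q). *)
Lemma sublinear_straighten f q : sublinear f ->
  exists g, [/\ sublinear g, forall p, g p <= f p & g (- q) <= - f q].
Proof.
move=> fs; have [fD fZ] := fs.
pose E p := [set f (p + t *: q) - t * f q | t in [set t : R | 0 <= t]].
have fq t : 0 <= t -> t * f q <= f (t *: q).
  rewrite le_eqVlt => /orP[/eqP <-|t0]; first by rewrite mul0r scale0r sublinear0.
  have := fZ t^-1 (t *: q); rewrite invr_gt0 t0 scalerA mulVf ?gt_eqF// scale1r.
  by move=> /(_ isT); rewrite ler_pdivlMl.
have Elb p : has_lbound (E p).
  exists (- f (- p)) => _ [t /= t0 <-].
  by have := fD (p + t *: q) (- p); rewrite addrAC subrr add0r; have := fq t t0; lra.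
have E0 p : E p !=set0 by exists (f (p + 0 *: q) - 0 * f q); exists 0 => //=.
have le_inf p t : 0 <= t -> inf (E p) <= f (p + t *: q) - t * f q.
  by move=> t0; apply: (ge_inf (Elb p)); exists t.
exists (fun p => inf (E p)); split.
- split=> [p p'|c p c0].
    rewrite -lerBlDr; apply: lb_le_inf (E0 p) _ => _ [t /= t0 <-].
    rewrite lerBlDr -lerBlDl; apply: lb_le_inf (E0 p') _ => _ [t' /= t'0 <-].
    have := le_inf (p + p') (t + t') (addr_ge0 t0 t'0).
    have := fD (p + t *: q) (p' + t' *: q).
    rewrite addrACA -scalerDl; lra.
  rewrite mulrC -ler_pdivrMr//; apply: lb_le_inf (E0 p) _ => _ [t /= t0 <-].
  rewrite ler_pdivrMr//.
  have := le_inf (c *: p) (c * t) (mulr_ge0 (ltW c0) t0).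
  rewrite -scalerA -scalerDr; have := fZ c (p + t *: q) c0.
  lra.
- by move=> p; have := le_inf p 0 (lexx _); rewrite scale0r addr0 mul0r subr0.
- by have := le_inf (- q) 1 ler01; rewrite scale1r addNr sublinear0// mul1r sub0r.
Qed.

(** Finite-dimensional Hahn-Banach: straightening along [q], then along every basis vector, leaves a
    linear minorant. Later minorants keep g(-q) <= -f(q), so the value at [q] survives. *)
Lemma sublinear_support f q : sublinear f ->
  exists u, (forall p, lf u p <= f p) /\ lf u q = f q.
Proof.
move=> fs.
have [g [gs gf gq]] : exists g, [/\ sublinear g, forall p, g p <= f p &
    (forall i, g (- delta_mx 0 i) <= - g (delta_mx 0 i)) /\ g (- q) <= - f q].
  have [f1 [f1s f1f f1q]] := sublinear_straighten q fs.
  suff H (s : seq 'I_d) : exists g, [/\ sublinear g, forall p, g p <= f1 p &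
      forall i, i \in s -> g (- delta_mx 0 i) <= - g (delta_mx 0 i)].
    have [g [gs gf1 gi]] := H (enum 'I_d); exists g; split=> //.
      by move=> p; apply: le_trans (gf1 p) (f1f p).
    split=> [i|]; first by rewrite gi// mem_enum.
    by apply: le_trans (gf1 _) f1q.
  elim: s => [|i s [g [gs gf1 gi]]]; first by exists f1; split.
  have [g' [g's g'g g'i]] := sublinear_straighten (delta_mx 0 i) gs.
  exists g'; split=> // [p|j]; first by apply: le_trans (g'g p) (gf1 p).
  rewrite inE => /orP[/eqP ->|/gi gj].
    by apply: le_trans g'i _; rewrite lerN2.
  apply: le_trans (g'g _) _; apply: le_trans gj _.
  by rewrite lerN2.
case: gq => gi gq; have [gD gZ] := gs.
pose u : 'cV[R]_d := \col_i g (delta_mx 0 i).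
have gu p : g p <= lf u p.
  rewrite lfE [p in g p]row_sum_delta.
  apply: (big_ind2 (fun a b => g a <= b)).
  - by rewrite sublinear0.
  - by move=> a b a' b' ab a'b'; apply: le_trans (gD _ _) (lerD ab a'b').
  - move=> i _; rewrite mxE; have [p0|p0|<-] := ltgtP 0 (p 0 i).
    + exact: gZ.
    + have := gZ (- p 0 i) (- delta_mx 0 i); rewrite scalerN scaleNr opprK oppr_gt0.
      by move=> /(_ p0); have := gi i; nra.
    + by rewrite scale0r mul0r sublinear0.
have ug p : lf u p <= g p.
  by have := gu (- p); rewrite lfN; have := sublinear_opp p gs; lra.
exists u; split=> [p|]; first exact: le_trans (ug p) (gf p).
apply/eqP; rewrite eq_le (le_trans (ug q) (gf q)) /=.
by have := ug (- q); rewrite lfN; have := gu (- q); rewrite lfN; lra.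
Qed.

End Sublinear.

(** * Gauge norms of symmetric convex bodies *)

Section Body.
Variables (R : realType) (d : nat).
Implicit Types (K : set 'rV[R]_d) (p q : 'rV[R]_d).

Lemma convex_setP K : convex_set K <->
  forall p q (t : R), 0 <= t <= 1 -> K p -> K q -> K ((1 - t) *: p + t *: q).
Proof.
split=> [Kc p q t /andP[t0 t1] Kp Kq|Kc p q t].
  have := Kc q p (Itv01 t0 t1) (mem_set Kq) (mem_set Kp).
  by rewrite inE addrC.
rewrite !inE => Kp Kq; have := Kc q p t%:inum _ Kq Kp; rewrite addrC; apply.
by rewrite ge0 le1.
Qed.

Lemma coord_le_norm p i : `|p 0 i| <= `|p|.
Proof.
by rewrite -[leRHS]/(mx_norm p) mx_normrE; apply/bigmax_geP; right => /=; exists (0, i).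
Qed.

Section Norm.
Variable K : set 'rV[R]_d.
Hypothesis Kb : o_symmetric_body K.

Lemma body_sym p : K p -> K (- p). Proof. by case: Kb => _ _ _; apply. Qed.

Lemma body_convex p q (t : R) : 0 <= t <= 1 -> K p -> K q -> K ((1 - t) *: p + t *: q).
Proof. by case: Kb => _ /convex_setP Kc _ _; exact: Kc. Qed.

Lemma body_closed : closed K.
Proof. by case: Kb => Kc _ _ _; apply: compact_closed Kc; exact: norm_hausdorff. Qed.

Lemma body_bounded : exists2 B : R, 0 < B & forall p, K p -> forall i, `|p 0 i| <= B.
Proof.
case: Kb => /compact_bounded[B [_ HB]] _ _ _.
exists (`|B| + 1); first by rewrite ltr_wpDl.
move=> p Kp i; apply: le_trans (coord_le_norm p i) (HB _ _ _ Kp).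
by rewrite (le_lt_trans (ler_norm _))// ltrDl.
Qed.

Lemma body_box : exists2 r : R, 0 < r & forall p, (forall i, `|p 0 i| < r) -> K p.
Proof.
case: (Kb) => _ _ [c /nbhs_box[r r0 rK]] _; exists r => // p pr.
have Kp : K (c + p) by apply: rK => i; rewrite mxE addrAC subrr add0r.
have Kq : K (p - c).
  rewrite -opprB; apply: body_sym; apply: rK => i.
  by rewrite !mxE addrAC subrr add0r normrN.
have -> : p = (1 - 2^-1) *: (c + p) + 2^-1 *: (p - c).
  by apply/rowP => i; rewrite !mxE; field.
by apply: body_convex => //; lra.
Qed.

Lemma body0 : K 0.
Proof. by have [r r0] := body_box; apply=> i; rewrite mxE normr0. Qed.

Lemma body_scale (t : R) p : 0 <= t <= 1 -> K p -> K (t *: p).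
Proof. by move=> t01 Kp; have := body_convex t01 body0 Kp; rewrite scaler0 add0r. Qed.

Lemma gauge_scale (l l' : R) p : 0 < l -> l <= l' -> K (l^-1 *: p) -> K (l'^-1 *: p).
Proof.
move=> l0 ll'; have l'0 := lt_le_trans l0 ll'.
move=> /(@body_scale (l / l')); rewrite scalerA mulrAC divff ?gt_eqF// mul1r.
by apply; rewrite (divr_ge0 (ltW l0) (ltW l'0)) /= ler_pdivrMr// mul1r.
Qed.

Let A p := [set l : R | 0 <= l /\ [set l *: q | q in K] p].

Let gaugeE (l : R) p : 0 < l -> A p l <-> K (l^-1 *: p).
Proof.
move=> l0; split=> [[_ [q Kq <-]]|Kp].
  by rewrite scalerA mulVf ?gt_eqF// scale1r.
split; first exact: ltW.
by exists (l^-1 *: p) => //; rewrite scalerA mulfV ?gt_eqF// scale1r.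
Qed.

Let A_lb p : has_lbound (A p). Proof. by exists 0 => l []. Qed.

Let A_neq0 p : exists2 l : R, 0 < l & A p l.
Proof.
have [r r0 rK] := body_box.
pose b := 1 + \sum_i `|p 0 i|.
have b0 : 0 < b by rewrite ltr_wpDr// sumr_ge0.
have l0 : 0 < b / r by rewrite divr_gt0.
exists (b / r) => //; apply/(gaugeE _ l0)/rK => i.
have pib : `|p 0 i| < b.
  rewrite /b (bigD1 i)//=; set s := \sum_(_ < _ | _) _.
  have : 0 <= s by apply: sumr_ge0.
  lra.
rewrite mxE normrM ger0_norm ?invr_ge0 ?ltW// invf_div mulrAC ltr_pdivrMr//.
by rewrite ltr_pM2l.
Qed.

Lemma normK_ge0 p : 0 <= normK K p.
Proof. by have [l _ Al] := A_neq0 p; apply: lb_le_inf; [exists l|move=> l' []]. Qed.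

(** The infimum is attained: p / l scaled by any factor 1 - h < 1 lies in [K], and [K] is closed. *)
Lemma normK_le (l : R) p : 0 < l -> normK K p <= l <-> K (l^-1 *: p).
Proof.
move=> l0; split=> [pl|/(gaugeE _ l0) Al]; last exact: ge_inf (A_lb p) _ Al.
apply: (closed_ray (v := - (l^-1 *: p)) body_closed) => h /andP[h0 h1].
rewrite scalerN -{1}[_ *: p]scale1r -scalerBl scalerA.
have [->|h1'] := eqVneq h 1; first by rewrite subrr mul0r scale0r; exact: body0.
have h1'' : 0 < 1 - h by rewrite subr_gt0 lt_neqAle h1'.
have [a Aa al] : exists2 a, A p a & a < l / (1 - h).
  apply: inf_lt; first by have [a _ Aa] := A_neq0 p; exists a.
  by apply: le_lt_trans pl _; rewrite ltr_pdivlMr// gtr_pMr// gtrBl.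
have -> : (1 - h) / l = (l / (1 - h))^-1 by rewrite invf_div.
have [a0 _] := Aa; rewrite le_eqVlt in a0; case/orP: a0 => [/eqP a0|a0].
  by case: Aa => _ [q _ <-]; rewrite -a0 scale0r scaler0; exact: body0.
by apply: (gauge_scale a0 (ltW al)); apply/(gaugeE p a0).
Qed.

Lemma normK_sublinear : sublinear (normK K).
Proof.
have attained p (e : R) : 0 < e -> 0 < normK K p + e /\ K ((normK K p + e)^-1 *: p).
  move=> e0; have pe : 0 < normK K p + e by rewrite ltr_wpDl// normK_ge0.
  by split=> //; apply/normK_le => //; rewrite lerDl ltW.
split=> [p q|c p c0]; apply/ler_addgt0Pr => e e0.
  have [a0 Ka] := attained p (e / 2) (divr_gt0 e0 (ltr0Sn _ _)).
  have [b0 Kb'] := attained q (e / 2) (divr_gt0 e0 (ltr0Sn _ _)).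
  have -> : normK K p + normK K q + e = (normK K p + e / 2) + (normK K q + e / 2).
    by field.
  move: (normK K p + _) (normK K q + _) a0 Ka b0 Kb' => a b a0 Ka b0 Kb'.
  apply/normK_le; first exact: addr_gt0.
  have -> : (a + b)^-1 *: (p + q) =
      (1 - b / (a + b)) *: (a^-1 *: p) + (b / (a + b)) *: (b^-1 *: q).
    rewrite !scalerA scalerDr; congr (_ *: _ + _ *: _); field.
      by rewrite !gt_eqF// addr_gt0.
    by rewrite !gt_eqF// addr_gt0.
  apply: body_convex => //; rewrite divr_ge0 ?ltW ?addr_gt0//=.
  by rewrite ltr_pdivrMr ?addr_gt0// mul1r ltrDr.
have [a0 Ka] := attained p (e / c) (divr_gt0 e0 c0).
have -> : c * normK K p + e = c * (normK K p + e / c) by field; rewrite gt_eqF.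
apply/normK_le; first exact: mulr_gt0.
by rewrite invfM scalerA mulrAC mulVf ?mul1r// gt_eqF.
Qed.

Lemma normK0 : normK K 0 = 0.
Proof. exact: sublinear0 normK_sublinear. Qed.

Lemma normKN p : normK K (- p) = normK K p.
Proof.
have le q : normK K (- q) <= normK K q.
  apply/ler_addgt0Pr => e e0; have qe : 0 < normK K q + e by rewrite ltr_wpDl// normK_ge0.
  by apply/(normK_le _ qe); rewrite scalerN; apply/body_sym/(normK_le _ qe); rewrite lerDl ltW.
by apply/eqP; rewrite eq_le le -[X in normK K X <= _]opprK le.
Qed.

Lemma normK_gt0 p : p != 0 -> 0 < normK K p.
Proof.
move=> p0; rewrite lt_def normK_ge0 andbT; apply: contraNneq p0 => np.
have [B B0 KB] := body_bounded.
apply/eqP/rowP => i; rewrite mxE; apply/eqP; rewrite -normr_le0.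
apply/ler_addgt0Pr => e e0; rewrite add0r.
have eB : 0 < e / B by rewrite divr_gt0.
have : K ((e / B)^-1 *: p) by apply/(normK_le _ eB); rewrite np ltW.
move=> /KB/(_ i); rewrite mxE normrM gtr0_norm ?invr_gt0// ler_pdivrMl//.
by rewrite divfK ?gt_eqF.
Qed.

Lemma normK_sum (I : finType) (a : I -> R) (v : I -> 'rV[R]_d) (c : R) :
  (forall i, 0 <= a i) -> \sum_i a i = 1 -> (forall i, normK K (v i) <= c) ->
  normK K (\sum_i a i *: v i) <= c.
Proof.
move=> a0 a1 vc; have [nD nZ] := normK_sublinear.
rewrite -[c]mul1r -a1 mulr_suml; apply: (big_ind2 (fun p b => normK K p <= b)).
- by rewrite normK0.
- by move=> p b p' b' pb p'b'; apply: le_trans (nD _ _) (lerD pb p'b').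
- move=> i _; have [ai|ai|<-] := ltgtP 0 (a i).
  + by apply: le_trans (nZ _ _ ai) _; rewrite ler_pM2l.
  + by have := a0 i; rewrite leNgt ai.
  + by rewrite scale0r mul0r normK0.
Qed.

Lemma normK_support q : exists u, (forall p, lf u p <= normK K p) /\ lf u q = normK K q.
Proof. exact: sublinear_support normK_sublinear. Qed.

Section Diameter.
Variables (n : nat) (x : 'I_n -> 'rV[R]_d).

Lemma diam_ge0 : 0 <= diam x K.
Proof. exact: bigmax_ge_id. Qed.

Lemma normK_le_diam i j : normK K (x i - x j) <= diam x K.
Proof.
have lt (a b : 'I_n) : (a < b)%N -> normK K (x a - x b) <= diam x K.
  by move=> ab; apply: (le_bigmax_cond _ (j := (a, b))).
have [/lt//|/lt|/val_inj ->] := ltngtP i j; first by rewrite -opprB normKN.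
by rewrite subrr normK0 diam_ge0.
Qed.

Lemma diam_le c : 0 <= c -> (forall i j, normK K (x i - x j) <= c) -> diam x K <= c.
Proof. by move=> c0 xc; apply: bigmax_le. Qed.

(** The support functional of the norm at x_i - x_j is at most the diameter on all differences and
    equal to it on this one, so it is maximal at [x i] and minimal at [x j]. *)
Lemma diametral_antipodal i j : 0 < diam x K ->
  normK K (x i - x j) = diam x K -> antipodal x i j.
Proof.
move=> D0 ij; apply: antipodal_sym; have [u [uK uij]] := normK_support (x i - x j).
have D l m : lf u (x l) - lf u (x m) <= diam x K.
  by rewrite -lfB; apply: le_trans (uK _) (normK_le_diam l m).
have Dij : lf u (x i) - lf u (x j) = diam x K by rewrite -lfB uij.
exists u; split=> [|l]; first lra.
by have := D l j; have := D i l; lra.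
Qed.

End Diameter.

End Norm.

Lemma polytope_body (J : finType) (f : J -> 'cV[R]_d) (c : J -> R) (M : R) :
  (forall j, 0 < c j) ->
  (forall p, (forall j, `|lf (f j) p| <= c j) -> forall i, `|p 0 i| <= M) ->
  o_symmetric_body [set p | forall j, `|lf (f j) p| <= c j].
Proof.
move=> c0 HM; set K := [set p | _]; split.
- apply: (subclosed_compact (B := [set p : 'rV[R]_d | forall i, p ord0 i \in `[- M, M]])).
  + have -> : K = \bigcap_j (fun p => `|lf (f j) p|) @^-1` [set l | l <= c j].
      apply/seteqP; split=> p Kp j; first by move=> _; exact: Kp.
    exact: (Kp j I).
    apply: closed_bigI => j _; apply: (continuous_closedP _).1; last exact: closed_le.
    by move=> p; apply: (@cvg_norm _ _ _ _ (nbhs_filter p)); exact: lf_continuous.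
  + apply: (@rV_compact _ _ (fun=> `[- M, M]%classic)) => i; exact: segment_compact.
  + by move=> p /HM pM i; rewrite in_itv/= -ler_norml.
- apply/convex_setP => p q t /andP[t0 t1] Kp Kq j.
  rewrite lfD !lfZ; have := Kp j; have := Kq j; rewrite !ler_norml.
  move=> /andP[? ?] /andP[? ?]; nra.
- exists 0; rewrite /interior.
  apply: (@filter_forall _ _ (fun j (p : 'rV[R]_d) => `|lf (f j) p| <= c j) _
    (nbhs_filter (0 : 'rV[R]_d))) => j.
  have : `|lf (f j) p| @[p --> (0 : 'rV[R]_d)] --> `|lf (f j) 0|.
    by apply: (@cvg_norm _ _ _ _ (nbhs_filter (0 : 'rV[R]_d))); exact: lf_continuous.
  move=> /(@cvgr_lt _ _ _ (nbhs_filter _) _ _)/(_ (c j)); rewrite lf0 normr0 => /(_ (c0 j)).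
  by apply: filterS => p /ltW.
- by move=> p Kp j; rewrite lfN normrN.
Qed.

End Body.

(** * Antipodal and diametral configurations *)

Section Configurations.
Variables (R : realType) (d n k : nat) (x : 'I_n -> 'rV[R]_d).

Lemma conv_hull_le (u : 'cV[R]_d) c p : (forall i, lf u (x i) <= c) ->
  conv_hull (range x) p -> lf u p <= c.
Proof.
move=> xc; apply: (smallest_sub (X := [set p | lf u p <= c])); last first.
  by move=> _ [i _ <-]; exact: xc.
apply/convex_setP => a b t /andP[t0 t1] /= ac bc.
by rewrite lfD !lfZ; nra.
Qed.

Lemma conv_hull_point i : conv_hull (range x) (x i).
Proof. by apply: sub_gen_smallest; exists i. Qed.

(** For the converse, a translation maps one hyperplane to the other, so the outer normals satisfy
    u2 = t u1. Distinctness excludes t > 0, where both would support from the same side; t < 0 turns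
    the second support into a lower bound for u1. *)
Lemma antipodal_hyperplanes i j :
  antipodal x i j <->
  exists H1 H2 : set 'rV[R]_d,
    [/\ supporting_hyperplane (conv_hull (range x)) H1,
        supporting_hyperplane (conv_hull (range x)) H2,
        parallel H1 H2, H1 <> H2 & H1 (x i) /\ H2 (x j)].
Proof.
split=> [[u [ij uP]]|[H1 [H2 [[u1 [c1 [u1_neq0 H1E _ H1P]]] [u2 [c2 [u2_neq0 H2E _ H2P]]]]]]].
  have u0 : u != 0 by apply: contraTneq ij => ->; rewrite /lf !mulmx0 ltxx.
  exists (hyperplane (- u) (- lf u (x i))), (hyperplane u (lf u (x j))); split.
  - exists (- u), (- lf u (x i)); split=> //; first by rewrite oppr_eq0.
      by exists (x i); split; [rewrite /hyperplane/= mulmxN mxE|exact: conv_hull_point].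
    move=> p; apply: conv_hull_le => l; rewrite lf_Nl lerN2.
    by have /andP[] := uP l.
  - exists u, (lf u (x j)); split=> //.
      by exists (x j); split=> //; exact: conv_hull_point.
    by move=> p; apply: conv_hull_le => l; have /andP[] := uP l.
  - exists (x j - x i); apply/seteqP; split=> p.
      rewrite /hyperplane/= => pj; exists (p - (x j - x i)); last by rewrite subrK.
      by rewrite -/(lf _ _) lf_Nl !lfB [lf u p]pj; congr (- _); ring.
    move=> [q + <-]; rewrite /hyperplane/= -!/(lf _ _) lf_Nl => /oppr_inj qi.
    by rewrite lfD lfB qi; ring.
  - move=> /seteqP[/(_ (x i)) + _]; rewrite /hyperplane/= mulmxN mxE => /(_ erefl) E.
    by move: ij; rewrite /lf E ltxx.
  - by rewrite /hyperplane/= mulmxN mxE.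
move=> [v H2v] H12 [H1i H2j].
have H1p p : H1 p <-> lf u1 p = c1 by rewrite H1E.
have H2p p : H2 p <-> lf u2 p = c2 by rewrite H2E.
have ker p : lf u1 p = 0 -> lf u2 p = 0.
  move=> p0; have i2 : H2 (x i + v) by rewrite H2v; exists (x i).
  have ip2 : H2 (x i + p + v).
    by rewrite H2v; exists (x i + p) => //; apply/H1p; rewrite lfD p0 addr0; apply/H1p.
  move: i2 ip2 => /H2p + /H2p; rewrite addrAC [lf u2 (_ + p)]lfD => ->.
  by rewrite -[RHS]addr0 => /addrI.
have [z z1] : exists z, lf u1 z = 1.
  have [l ul] : exists l, u1 l 0 != 0.
    apply: contrapT => H; move/eqP: u1_neq0; apply; apply/colP => l; rewrite mxE.
    by apply/eqP; apply: contrapT => ul; apply: H; exists l; apply/negP.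
  exists ((u1 l 0)^-1 *: delta_mx 0 l); rewrite lfZ lfE (bigD1 l)//= mxE !eqxx mul1r.
  rewrite big1 ?addr0 ?mulVf// => m /negbTE ml.
  by rewrite mxE ml andbF mul0r.
pose t := lf u2 z.
have u2E p : lf u2 p = t * lf u1 p.
  have := ker (p - lf u1 p *: z); rewrite !lfB !lfZ z1 mulr1 subrr => /(_ erefl)/eqP.
  by rewrite subr_eq0 mulrC => /eqP.
have t0 : t != 0.
  apply: contraNneq u2_neq0 => t0; apply/eqP/colP => l; rewrite mxE -[u2 l 0]mul1r.
  have := u2E (delta_mx 0 l); rewrite t0 mul0r lfE (bigD1 l)//= mxE !eqxx.
  rewrite big1 ?addr0// => m /negbTE ml.
  by rewrite mxE ml andbF mul0r.
have i1 := (H1p _).1 H1i; have j2 := (H2p _).1 H2j.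
have le1 l : lf u1 (x l) <= c1 by apply: H1P; exact: conv_hull_point.
have le2 l : t * lf u1 (x l) <= c2 by rewrite -u2E; apply: H2P; exact: conv_hull_point.
have ij : lf u1 (x i) != lf u1 (x j).
  apply/eqP => ij; apply: H12; apply/seteqP; split=> p.
    by move=> /H1p p1; apply/H2p; rewrite u2E p1 -i1 ij -u2E j2.
  move=> /H2p p2; apply/H1p; apply: (mulfI t0).
  by rewrite -u2E p2 -i1 ij -u2E j2.
have tn : t < 0.
  rewrite lt_neqAle t0 leNgt; apply/negP => tp; move/eqP: ij; apply.
  apply/eqP; rewrite eq_le [X in _ && X](_ : _ = true); last by rewrite i1 le1.
  rewrite andbT -(ler_pM2l tp); apply: le_trans (le2 i) _.
  by rewrite -j2 u2E.
apply: antipodal_sym; exists u1; split=> [|l].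
  by rewrite lt_neqAle eq_sym ij i1 le1.
rewrite i1 le1 andbT -(ler_nM2l tn); apply: le_trans (le2 l) _.
by rewrite -j2 u2E.
Qed.

Lemma increasing_subset (Q : 'I_n -> 'I_n -> Prop) :
  (forall s : 'I_k -> 'I_n, {homo s : i j / (i < j)%N} ->
    exists i j : 'I_k, (i < j)%N /\ Q (s i) (s j)) ->
  forall A : {set 'I_n}, (k <= #|A|)%N -> exists a b, [/\ a \in A, b \in A & Q a b].
Proof.
move=> H A kA.
pose s (i : 'I_k) := enum_val (widen_ord kA i).
have [|i [j [_ ij]]] := H s; last by exists (s i), (s j); split=> //; exact: enum_valP.
move=> i j ij; rewrite /s.
have A0 : 'I_n by exact: (enum_val (widen_ord kA i)).
rewrite !(enum_val_nth A0).
have sA : sorted ltn (map val (enum A)).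
  apply: (subseq_sorted ltn_trans (s2 := iota 0 n)); last exact: iota_ltn_sorted.
  by rewrite -val_enum_ord map_subseq// enumT filter_subseq.
have := sorted_ltn_nth ltn_trans 0%N sA; rewrite size_map -cardE => /(_ i j).
rewrite !inE => /(_ (leq_trans (ltn_ord i) kA) (leq_trans (ltn_ord j) kA) ij).
by rewrite !(nth_map A0)// -cardE ?(leq_trans (ltn_ord _) kA).
Qed.

Lemma k_antipodal_subset : k_antipodal x k -> forall A : {set 'I_n}, (k <= #|A|)%N ->
  exists a b, [/\ a \in A, b \in A & antipodal x a b].
Proof.
move=> xk; apply: increasing_subset => s /xk[i [j [ij H]]]; exists i, j; split=> //.
exact/antipodal_hyperplanes.
Qed.

Lemma k_antipodal_bound : (0 < k)%N -> k_antipodal x k -> (n <= k.-1 * 2 ^ d)%N.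
Proof.
move=> k0 /k_antipodal_subset xk.
have [w wP] := separating_functionals x.
have [M _ xM] := family_bound x.
by apply: (antipodal_bound wP xM) => A; rewrite prednK//; exact: xk.
Qed.

Lemma diametral_k_antipodal K : o_symmetric_body K -> k_diametral x K k -> k_antipodal x k.
Proof.
move=> Kb [D0 xk] s /xk[i [j [ij sij]]]; exists i, j; split=> //.
exact/antipodal_hyperplanes/(diametral_antipodal Kb D0 sij).
Qed.

Lemma k_antipodal_diametral : ~ (forall i j, x i = x j) -> k_antipodal x k ->
  exists K : set 'rV[R]_d, o_symmetric_body K /\ k_diametral x K k.
Proof.
move=> nx xk.
have [w wP] := separating_functionals x.
have [M M0 xM] := family_bound x.
pose anti (ij : 'I_n * 'I_n) := `[< antipodal x ij.1 ij.2 >].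
(* The coordinate slabs make the ball bounded; 2M suffices for differences of points. A pair that is
   not antipodal gets the vacuous slab 0 <= 1. *)
pose f (t : 'I_d + 'I_n * 'I_n) : 'cV[R]_d := match t with
  | inl i => delta_mx i 0 | inr ij => if anti ij then w ij.1 ij.2 else 0 end.
pose c (t : 'I_d + 'I_n * 'I_n) : R := match t with
  | inl i => 2 * M
  | inr ij => if anti ij then lf (w ij.1 ij.2) (x ij.2) - lf (w ij.1 ij.2) (x ij.1) else 1
  end.
have c0 t : 0 < c t.
  case: t => [i|[i j]] /=; first by rewrite mulr_gt0.
  by case: ifP => // /asboolP/wP[] /=; rewrite subr_gt0.
pose K := [set p | forall t, `|lf (f t) p| <= c t].
have Kb : o_symmetric_body K.
  apply: (@polytope_body _ _ _ f c (2 * M)) => // p Kp i.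
  by have := Kp (inl i); rewrite /f/c lf_delta.
have le1 i j : normK K (x i - x j) <= 1.
  apply/(normK_le Kb _ ltr01); rewrite invr1 scale1r => -[l|ab].
    rewrite /f /c lf_delta !mxE; apply: le_trans (ler_normB _ _) _.
    by rewrite mulr2n mulrDl mul1r lerD// ltW// xM.
  rewrite /f /c; case: ifP => [/asboolP/wP[_ H]|_]; last first.
    by rewrite /lf mulmx0 mxE normr0.
  rewrite lfB ler_norml; have /andP[? ?] := H i; have /andP[? ?] := H j.
  by apply/andP; split; lra.
have ge1 i j : antipodal x i j -> 1 <= normK K (x i - x j).
  move=> ij; rewrite leNgt; apply/negP => lt1.
  pose l := (normK K (x i - x j) + 1) / 2.
  have l0 : 0 < l by have := normK_ge0 Kb (x i - x j); rewrite /l; lra.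
  have : K (l^-1 *: (x i - x j)) by apply/(normK_le Kb _ l0); rewrite /l; lra.
  move=> /(_ (inr (i, j))); rewrite /f /c /anti asboolT//= lfZ lfB normrM.
  have [wij _] := wP i j ij; set A := lf _ _ in wij *; set B := lf _ _ in wij *.
  rewrite gtr0_norm ?invr_gt0// ltr0_norm ?subr_lt0// ler_pdivrMl//.
  have : l < 1 by rewrite /l; lra.
  by nra.
exists K; split=> //.
have D1 : diam x K <= 1 by apply: diam_le => //.
split.
  have [i [j ij]] : exists i j, x i != x j.
    apply: contrapT => H; apply: nx => i j; apply: contrapT => /eqP ij.
    by apply: H; exists i, j.
  by apply: lt_le_trans (normK_le_diam Kb x i j); apply: normK_gt0; rewrite // subr_eq0.
move=> s /xk[i [j [ij /antipodal_hyperplanes/ge1 H]]]; exists i, j; split=> //.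
apply/eqP; rewrite eq_le normK_le_diam//=.
exact: le_trans D1 H.
Qed.

End Configurations.

(** * The unit ball of an extremal configuration *)

Section ExtremalBody.
Variables (R : realType) (d k : nat) (K : set 'rV[R]_d).
Hypothesis k2 : (2 <= k)%N.
Hypothesis Kb : o_symmetric_body K.

Lemma fk_bound n (x : 'I_n -> 'rV[R]_d) : k_diametral x K k -> (n <= k.-1 * 2 ^ d)%N.
Proof.
move=> /(diametral_k_antipodal Kb); apply: k_antipodal_bound.
exact: leq_trans k2.
Qed.

Lemma extremal_diametral (x : 'I_(k.-1 * 2 ^ d) -> 'rV[R]_d) : k_diametral x K k ->
  affine_cube K /\ exists Q : set 'rV[R]_d,
    [/\ affine_cube Q, homothetic Q K, forall i, vertices Q (x i) &
        forall p, vertices Q p -> #|[pred i | x i == p]| = k.-1].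
Proof.
move=> [D0 xk]; set D := diam x K in D0 xk.
have k'_gt0 : (0 < k.-1)%N by rewrite -ltnS prednK// (leq_trans _ k2).
pose related (p q : 'rV[R]_d) := normK K (p - q) = D.
have [| | | |T [y [coverP relP x_in fiber Tcard]]] :=
    @extremal_structure R d _ k.-1 x related erefl k'_gt0.
- by move=> p; rewrite /related subrr normK0// => D0'; rewrite -D0' ltxx in D0.
- by move=> p q; rewrite /related -opprB normKN.
- by move=> i j ij; exact: (diametral_antipodal Kb D0 ij).
- move=> A; rewrite prednK ?(leq_trans _ k2)// => kA.
  exact: (@increasing_subset _ _ (fun a b => related (x a) (x b)) xk A kA).
have /card_gt0P[a0 _] : (0 < #|T|)%N by rewrite Tcard expn_gt0.
have antiP s t : s != t -> antipodal y s t by move=> /relP[].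
have normD s t : normK K (y s - y t) <= D.
  have [->|/relP[->]//] := eqVneq s t; by rewrite subrr normK0// ltW.
have [S [phi [TS dual hullE corners]]] := cube_structure coverP antiP a0.
have Sd : #|S| = d by apply/eqP; rewrite -(eqn_exp2l _ _ (ltnSn 1)) -TS Tcard.
pose f (i : 'I_d) : T := enum_val (cast_ord (esym Sd) i).
have fS i : f i \in S by exact: enum_valP.
have finj : injective f by move=> i j /enum_val_inj/cast_ord_inj.
pose e i := y (f i) - y a0.
have sumS (F : T -> 'rV[R]_d) : \sum_(t in S) F t = \sum_i F (f i).
  rewrite big_enum_val /=; apply: reindex; exists (cast_ord Sd) => i _.
    by rewrite cast_ordKV.
  by rewrite cast_ordK.
pose A : 'M[R]_d := \matrix_i e i.
have mulA (q : 'rV[R]_d) : q *m A = \sum_i q 0 i *: e i.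
  by rewrite mulmx_sum_row; apply: eq_bigr => i _; rewrite rowK.
have A_unit : A \in unitmx.
  pose G : 'M[R]_d := \matrix_(i, j) phi (f j) i 0.
  suff AG : A *m G = 1%:M by have [] := mulmx1_unit AG.
  apply/matrixP => i j; rewrite !mxE.
  have -> : (i == j)%:R = lf (phi (f j)) (e i) :> R by rewrite dual// (inj_eq finj).
  by rewrite lfE; apply: eq_bigr => l _; rewrite !mxE.
have hullA p : hull y p <-> exists2 q : 'rV[R]_d, unit_cube q & p = q *m A + y a0.
  split=> [/hullE[a [a01 ->]]|[q q01 ->]].
    exists (\row_i a (f i)); first by move=> i; rewrite mxE a01.
    rewrite addrC mulA sumS; congr (_ + _); apply: eq_bigr => i _.
    by rewrite mxE.
  pose g t := if [pick i | f i == t] is Some i then q 0 i else 0.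
  have gf i : g (f i) = q 0 i.
    rewrite /g; case: pickP => [j /eqP/finj -> //|/(_ i)].
    by rewrite eqxx.
  apply/hullE; exists g; split=> [t tS|].
    by rewrite /g; case: pickP => [i _|_]; [exact: q01|rewrite lexx ler01].
  rewrite addrC mulA sumS; congr (_ + _); apply: eq_bigr => i _.
  by rewrite gf.
have D_neq0 : D != 0 by rewrite gt_eqF.
have KA p : K p <-> exists2 q : 'rV[R]_d, (forall i, `|q 0 i| <= D^-1) & p = q *m A.
  split=> [Kp|[q qD ->]].
    exists (p *m invmx A); last by rewrite mulmxKV.
    move=> j; set q := p *m _; have pE : p = q *m A by rewrite mulmxKV.
    have [h [hK hj]] := normK_support Kb (e j).
    have ej : normK K (e j) = D.
      suff /relP[//] : f j != a0 by [].
      apply/eqP => fja; have /eqP := dual _ _ (fS j) (fS j).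
      by rewrite {2}fja subrr lf0 eqxx eq_sym oner_eq0.
    (* The corner y_a0 + e_i + e_j is within D of [y a0], which gives h(e_i) <= 0; the diagonal e_j
       - e_i gives h(e_i) >= 0. *)
    have hi i : i != j -> lf h (e i) = 0.
      move=> ij; have fij : f i != f j by rewrite (inj_eq finj).
      have [|t yt] := corners [set f i; f j]%SET.
        by rewrite finset.subUset !finset.sub1set !fS.
      have h1 := le_trans (hK _) (normD t a0).
      rewrite yt addrAC subrr add0r big_setU1 ?big_set1 ?inE//= lfD in h1.
      have h2 := le_trans (hK _) (normD (f j) (f i)).
      have eji : y (f j) - y (f i) = e j - e i.
        by apply/rowP => l; rewrite !mxE; ring.
      rewrite -/(e i) -/(e j) hj ej in h1.
      by rewrite eji [lf _ _]lfB hj ej in h2; lra.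
    have hp : lf h p = q 0 j * D.
      rewrite pE mulA lf_sum (bigD1 j)//= lfZ hj ej big1 ?addr0// => i ij.
      by rewrite lfZ hi// mulr0.
    have le1 p' : K p' -> lf h p' <= 1.
      by move=> Kp'; apply: le_trans (hK _) _; apply/(normK_le Kb _ ltr01); rewrite invr1 scale1r.
    have := le1 _ Kp; have := le1 _ (body_sym Kb Kp); rewrite lfN hp => h1 h2.
    by rewrite -[D^-1]mul1r ler_pdivlMr// -[X in _ * X]gtr0_norm// -normrM ler_norml; lra.
  (* Positive and negative parts write D q A as a difference of two points of the parallelotope, and
     by convexity such differences have norm at most D. *)
  pose pos (c : R) := if 0 <= c then c else 0.
  have pos01 c : `|c| <= 1 -> 0 <= pos c <= 1.
    by rewrite ler_norml /pos; case: ifP => [c0 /andP[_ ->]|_ _]; rewrite ?c0 ?lexx ?ler01.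
  have posB c : pos c - pos (- c) = c.
    by rewrite /pos oppr_ge0; have [c0|c0|<-] := ltgtP 0 c; rewrite ?subr0 ?sub0r ?opprK ?oppr0.
  have Dq i : `|D * q 0 i| <= 1 by rewrite normrM gtr0_norm// -ler_pdivlMl// mulr1.
  pose z1 := (\row_i pos (D * q 0 i)) *m A + y a0.
  pose z2 := (\row_i pos (- (D * q 0 i))) *m A + y a0.
  have yz1 : hull y z1 by apply/hullA; exists (\row_i pos (D * q 0 i)) => // i; rewrite mxE pos01.
  have yz2 : hull y z2.
    by apply/hullA; exists (\row_i pos (- (D * q 0 i))) => // i; rewrite mxE pos01// normrN.
  have -> : q *m A = D^-1 *: (z1 - z2).
    rewrite /z1 /z2 opprD addrACA subrr addr0 -mulmxBl scalemxAl; congr (_ *m _).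
    by apply/rowP => i; rewrite !mxE posB mulKf.
  apply/(normK_le Kb _ D0).
  have le_y s z : hull y z -> normK K (z - y s) <= D.
    move=> [a [a_ge0 a1 ->]].
    have -> : \sum_t a t *: y t - y s = \sum_t a t *: (y t - y s).
      under [RHS]eq_bigr do rewrite scalerBr.
      by rewrite sumrB -scaler_suml a1 scale1r.
    exact: normK_sum.
  case: yz2 => [b [b_ge0 b1 ->]].
  have -> : z1 - \sum_t b t *: y t = \sum_t b t *: (z1 - y t).
    under [RHS]eq_bigr do rewrite scalerBr.
    by rewrite sumrB -scaler_suml b1 scale1r.
  by apply: normK_sum => // t; exact: le_y.
split.
  exists ((2 / D) *: A), (const_mx (- D^-1) *m A); split.
    by rewrite unitmxZ// unitfE mulf_neq0 ?invr_neq0.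
  apply/seteqP; split=> p.
    move=> /KA[q qD ->]; exists (\row_i ((q 0 i * D + 1) / 2)).
      move=> i; rewrite mxE; have := qD i; rewrite ler_norml => /andP[q1 q2].
      have : - 1 <= q 0 i * D by rewrite -(mulVf D_neq0) -mulNr ler_pM2r.
      have : q 0 i * D <= 1 by rewrite -[leRHS](mulVf D_neq0) ler_pM2r.
      by lra.
    rewrite -scalemxAr scalemxAl -mulmxDl; congr (_ *m _).
    by apply/rowP => i; rewrite !mxE; field.
  move=> [q q01 <-]; apply/KA; exists ((2 / D) *: q + const_mx (- D^-1)).
    move=> i; rewrite !mxE; have /andP[q0 q1] := q01 i.
    have D1 : 0 < D^-1 by rewrite invr_gt0.
    rewrite mulrAC ler_norml; nra.
  by rewrite mulmxDl -scalemxAl scalemxAr.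
exists (hull y); split.
- exists A, (y a0); split=> //; apply/seteqP; split=> p.
    by move=> /hullA[q q01 ->]; exists q.
  by move=> [q q01 <-]; apply/hullA; exists q.
(* The centre of the parallelotope, and the ratio of its half-width 1/2 to the half-width 1/D of
   [K]. *)
- exists (y a0 + const_mx 2^-1 *m A), (D / 2); split; first by rewrite divr_gt0.
  apply/seteqP; split=> p.
    move=> /hullA[q q01 ->]; exists ((2 / D) *: (q - const_mx 2^-1) *m A).
      apply/KA; exists ((2 / D) *: (q - const_mx 2^-1)) => // i; rewrite !mxE.
      have /andP[q0 q1] := q01 i; have D1 : 0 < D^-1 by rewrite invr_gt0.
      rewrite mulrAC ler_norml; nra.
    rewrite -[LHS]addrA [LHS]addrC; congr (_ + _).
    rewrite scalemxAl -mulmxDl; congr (_ *m _).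
    by apply/rowP => i; rewrite !mxE; field.
  move=> [_ /KA[q qD ->] <-]; apply/hullA; exists ((D / 2) *: q + const_mx 2^-1).
    move=> i; rewrite !mxE; have := qD i; rewrite ler_norml => /andP[q1 q2].
    have : - 1 <= D * q 0 i by rewrite -(mulfV D_neq0) -mulrN ler_pM2l.
    have : D * q 0 i <= 1 by rewrite -[leRHS](mulfV D_neq0) ler_pM2l.
    by rewrite mulrAC; lra.
  by rewrite -[LHS]addrA [LHS]addrC mulmxDl -scalemxAl [X in X + y a0]addrC.
- move=> i; have [t ->] := x_in i; split; first exact: hull_point.
  move=> a b c ya yb c01 E; exact: (extreme_vertex antiP c01 ya yb E).
- move=> p [[a [a_ge0 a1 pE]] p_ext].
  have [t ->] : exists t, p = y t.
    have [t at0] : exists t, 0 < a t.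
      apply: contrapT => H; have : \sum_t a t <= 0.
        by apply: sumr_le0 => t _; rewrite leNgt; apply/negP => ?; apply: H; exists t.
      by rewrite a1 ler10.
    exists t; have sE : \sum_(s | s != t) a s = 1 - a t by rewrite -a1 [in RHS](bigD1 t)//= addrAC subrr add0r.
    have at1 : a t <= 1 by rewrite -subr_ge0 -sE sumr_ge0.
    have [at1'|at1'] := eqVneq (a t) 1.
      rewrite pE (bigD1 t)//= at1' scale1r big1 ?addr0// => s st.
      move: sE; rewrite at1' subrr => sE.
      by rewrite (psumr_eq0P (fun s _ => a_ge0 s) sE st) scale0r.
    have nz : 1 - a t != 0 by rewrite subr_eq0 eq_sym.
    have at2 : 0 < 1 - a t by rewrite lt_def nz subr_ge0.
    (* The normalized rest: [p] lies strictly between [q] and [y t], so extremality gives p =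
       y_t. *)
    pose q := \sum_(s | s != t) (a s / (1 - a t)) *: y s.
    have yq : hull y q.
      apply: hull_comb => [s _||s _]; last exact: hull_point.
        by rewrite divr_ge0// ltW.
      by rewrite -mulr_suml sE divff.
    have [||_ ->//] := p_ext q (y t) (a t) yq (hull_point y t).
      by rewrite at0 -subr_gt0.
    rewrite pE (bigD1 t)//= addrC; congr (_ + _); rewrite /q scaler_sumr.
    by apply: eq_bigr => s _; rewrite scalerA mulrC divfK.
  exact: fiber.
Qed.

End ExtremalBody.

(** * Optimal configurations *)

Section CubeConfiguration.
Variables (R : realType) (d k : nat).
Hypothesis d1 : (1 <= d)%N.
Hypothesis k2 : (2 <= k)%N.

Lemma unit_cube_body : exists2 K : set 'rV[R]_d, o_symmetric_body K & affine_cube K.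
Proof.
exists [set p | forall j, `|lf (delta_mx j 0) p| <= (1 : R)].
  by apply: (@polytope_body _ _ _ _ _ 1) => // p pK i; rewrite -lf_delta.
exists (2%:M), (const_mx (-1)); split.
  by rewrite unitmxE det_scalar unitfE expf_neq0.
apply/seteqP; split=> [p pK|_ [q q01 <-] j].
  exists (2^-1 *: (p + const_mx 1)) => [i|].
    by have := pK i; rewrite lf_delta !mxE ler_norml => /andP[? ?]; apply/andP; split; lra.
  by rewrite mul_mx_scalar; apply/rowP => i; rewrite !mxE; field.
have /andP[? ?] := q01 j.
by rewrite lf_delta mul_mx_scalar !mxE ler_norml; apply/andP; split; lra.
Qed.

Lemma symmetric_cube (K : set 'rV[R]_d) : o_symmetric_body K -> affine_cube K ->
  exists2 A : 'M[R]_d, A \in unitmx &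
    forall q : 'rV[R]_d, K (q *m A) <-> forall i, `|q 0 i| <= 2^-1.
Proof.
move=> Kb [A [b [A_unit KE]]]; exists A => //.
have Ainj (q q' : 'rV[R]_d) : q *m A = q' *m A -> q = q'.
  by move=> E; rewrite -[q](mulmxK A_unit) E mulmxK.
have [c bE] : exists c, b = c *m A by exists (b *m invmx A); rewrite mulmxKV.
have memK q : K (q *m A) <-> unit_cube (q - c).
  rewrite KE; split=> [[q' q'01]|q01].
    by rewrite bE -mulmxDl => /Ainj <-; rewrite addrK.
  by exists (q - c) => //; rewrite bE -mulmxDl subrK.
(* Symmetry applied to the images of two opposite vertices of the unit cube fixes the
   translation. *)
have cE i : c 0 i = - 2^-1.
  have K0 : K (c *m A) by apply/memK => j; rewrite subrr mxE lexx ler01.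
  have K1 : K ((const_mx 1 + c) *m A).
    by apply/memK => j; rewrite addrK mxE ler01 lexx.
  have := body_sym Kb K0; have := body_sym Kb K1; rewrite -!mulNmx.
  move=> /memK/(_ i) + /memK/(_ i); rewrite !mxE => /andP[? ?] /andP[? ?].
  lra.
move=> q; rewrite memK; split=> H i; have := H i; rewrite !mxE cE ler_norml.
  by move=> /andP[? ?]; apply/andP; split; lra.
by move=> /andP[? ?]; apply/andP; split; lra.
Qed.

(** Index [i] sits at the vertex numbered i mod 2^d. Among [k] indices two differ modulo 2^d, as
    there are only k - 1 quotients; distinct vertices differ by 1 in a coordinate, hence have
    distance 2, as [K] has half-width 1/2. *)
Lemma cube_configuration (K : set 'rV[R]_d) : o_symmetric_body K -> affine_cube K ->
  exists x : 'I_(k.-1 * 2 ^ d) -> 'rV[R]_d, k_diametral x K k.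
Proof.
move=> Kb /(symmetric_cube Kb)[A A_unit KA].
have cardB : #|{ffun 'I_d -> bool}| = (2 ^ d)%N by rewrite card_ffun card_bool card_ord.
have p2 : (0 < 2 ^ d)%N by rewrite expn_gt0.
have mod_lt (i : nat) : (i %% 2 ^ d < #|{ffun 'I_d -> bool}|)%N by rewrite cardB ltn_pmod.
pose bit (i : nat) : {ffun 'I_d -> bool} := enum_val (Ordinal (mod_lt i)).
pose v (b : {ffun 'I_d -> bool}) : 'rV[R]_d := \row_j (b j)%:R.
pose x (i : 'I_(k.-1 * 2 ^ d)) := v (bit i) *m A.
have le2 i j : normK K (x i - x j) <= 2.
  apply/(normK_le Kb _ (ltr0Sn _ _)); rewrite -mulmxBl scalemxAl; apply/KA => l.
  rewrite !mxE normrM gtr0_norm ?invr_gt0// ger_pMr ?invr_gt0//.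
  by case: (bit i l); case: (bit j l); rewrite /= ?subrr ?subr0 ?sub0r ?normrN ?normr1 ?normr0.
have ge2 (i j : 'I_(k.-1 * 2 ^ d)) : bit i != bit j -> 2 <= normK K (x i - x j).
  move=> bij; have [l bl] : exists l, bit i l != bit j l.
    apply: contrapT => H; move/eqP: bij; apply; apply/ffunP => l.
    by apply: contrapT => /eqP bl; apply: H; exists l.
  rewrite leNgt; apply/negP => lt2.
  pose h := (normK K (x i - x j) + 2) / 2.
  have h0 : 0 < h by have := normK_ge0 Kb (x i - x j); rewrite /h; lra.
  have : K (h^-1 *: (x i - x j)) by apply/(normK_le Kb _ h0); rewrite /h; lra.
  rewrite -mulmxBl scalemxAl => /KA/(_ l); rewrite !mxE normrM gtr0_norm ?invr_gt0//.
  have -> : `|(bit i l)%:R - (bit j l)%:R| = 1 :> R.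
    by case: (bit i l) bl; case: (bit j l) => // _;
      rewrite /= ?subr0 ?sub0r ?normrN ?normr1.
  by rewrite mulr1 lef_pV2 ?posrE// leNgt; have -> : h < 2 by rewrite /h; lra.
have bitE i j : bit i = bit j -> (i %% 2 ^ d = j %% 2 ^ d)%N.
  by move=> /enum_val_inj/(congr1 val).
have k'0 : (0 < k.-1)%N by rewrite -ltnS prednK// (leq_trans _ k2).
have N2 : (1 < k.-1 * 2 ^ d)%N.
  apply: (@leq_trans (1 * 2 ^ d)); last by rewrite leq_mul2r k'0 orbT.
  by rewrite mul1n -{1}[1%N](expn0 2) ltn_exp2l.
have DE : diam x K = 2.
  apply/eqP; rewrite eq_le diam_le//=.
  apply: le_trans (normK_le_diam Kb x (Ordinal (ltnW N2)) (Ordinal N2)).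
  apply: ge2; apply/eqP => /bitE; rewrite /= mod0n modn_small//.
  by rewrite -{1}[1%N](expn0 2) ltn_exp2l.
exists x; split; rewrite DE// => s s_homo.
apply: contrapT => H.
have same (i j : 'I_k) : (i < j)%N -> bit (s i) = bit (s j).
  move=> ij; apply/eqP; apply: contrapT => /negP/ge2 bij; apply: H; exists i, j; split=> //.
  by apply/eqP; rewrite eq_le le2.
have q_lt (i : 'I_k) : (s i %/ 2 ^ d < k.-1)%N by rewrite ltn_divLR.
have : injective (fun i => Ordinal (q_lt i)).
  move=> i j [qij]; apply/val_inj.
  wlog ij : i j qij / (i < j)%N.
    move=> W; have [ij|ji|//] := ltngtP i j; first exact: W.
    by apply/esym; apply: W.
  have := s_homo i j ij; rewrite (divn_eq (s i) (2 ^ d)) (divn_eq (s j) (2 ^ d)) qij.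
  by rewrite (bitE _ _ (same i j ij)) ltnn.
move=> /leq_card; rewrite !card_ord => kk.
by move: (leq_trans kk (leq_pred k)); rewrite leqNgt -{2}[k]prednK ?ltnS ?kk// (leq_trans _ k2).
Qed.

(** Makes the set whose maximum is taken in [fk_exists] nonempty for every body. *)
Lemma two_point_configuration (K : set 'rV[R]_d) : o_symmetric_body K ->
  exists x : 'I_2 -> 'rV[R]_d, k_diametral x K k.
Proof.
move=> Kb; pose i0 := Ordinal d1; pose p : 'rV[R]_d := delta_mx 0 i0.
have p0 : p != 0.
  by apply/eqP => /rowP/(_ i0)/eqP; rewrite !mxE !eqxx oner_eq0.
pose x (i : 'I_2) : 'rV[R]_d := if (i : nat) == 0%N then p else 0.
have pair (i j : 'I_2) : (i < j)%N -> normK K (x i - x j) = normK K p.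
  by case: i j => [[|[|i]] Hi] [[|[|j]] Hj]//= _; rewrite /x /= subr0.
have DE : diam x K = normK K p.
  apply/eqP; rewrite eq_le; apply/andP; split.
    by apply: bigmax_le => [|[i j] /= ij]; [exact: normK_ge0|rewrite pair].
  by rewrite -(pair ord0 ord_max)//; exact: normK_le_diam.
exists x; split; rewrite DE; first exact: normK_gt0.
move=> s s_homo; have k0 : (0 < k)%N := ltnW k2.
exists (Ordinal k0), (Ordinal k2); split=> //.
by apply: pair; apply: s_homo.
Qed.

Lemma fk_exists (K : set 'rV[R]_d) : o_symmetric_body K -> exists m, fk_eq K k m.
Proof.
move=> Kb.
pose P n := `[< (0 < n)%N /\ exists x : 'I_n -> 'rV[R]_d, k_diametral x K k >].
have exP : exists n, P n.
  by exists 2%N; apply/asboolP; split=> //; exact: two_point_configuration.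
have boundP n : P n -> (n <= k.-1 * 2 ^ d)%N by move=> /asboolP[_ [x]]; exact: fk_bound.
exists (ex_maxn exP boundP); case: ex_maxnP => m /asboolP Pm m_max; split=> // n nP.
by rewrite /= leEnat; apply: m_max; apply/asboolP.
Qed.

Lemma fk_cube (K : set 'rV[R]_d) : o_symmetric_body K -> affine_cube K ->
  fk_eq K k (k.-1 * 2 ^ d)%N.
Proof.
move=> Kb Kc; split=> [|n [_ [x /(fk_bound k2 Kb)]]//].
split; last exact: cube_configuration.
by rewrite muln_gt0 expn_gt0 andbT -ltnS prednK// (leq_trans _ k2).
Qed.

End CubeConfiguration.

Theorem theorem8 (R : realType) (d k : nat) (hd : (2 <= d)%N) (hk : (2 <= k)%N) :
  (forall (n : nat) (x : 'I_n -> 'rV[R]_d),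
     ~ (forall i j : 'I_n, x i = x j) ->
     (k_antipodal x k <->
      exists K : set 'rV[R]_d, o_symmetric_body K /\ k_diametral x K k))
  /\
  [/\ Fk_eq R d k (k.-1 * 2 ^ d)%N,
      (forall K : set 'rV[R]_d, o_symmetric_body K ->
         exists m : nat, fk_eq K k m) &
      is_max [set m : nat | exists K : set 'rV[R]_d,
                o_symmetric_body K /\ fk_eq K k m]
        (k.-1 * 2 ^ d)%N]
  /\
  (forall K : set 'rV[R]_d, o_symmetric_body K ->
     (fk_eq K k (k.-1 * 2 ^ d)%N <-> affine_cube K) /\
     (affine_cube K ->
      forall x : 'I_(k.-1 * 2 ^ d) -> 'rV[R]_d, k_diametral x K k ->
      exists Q : set 'rV[R]_d,
        [/\ affine_cube Q, homothetic Q K,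
            (forall i, vertices Q (x i)) &
            forall p : 'rV[R]_d, vertices Q p ->
              #|[pred i | x i == p]| = k.-1])).
Proof.
have d1 : (1 <= d)%N := ltnW hd.
have N0 : (0 < k.-1 * 2 ^ d)%N.
  by rewrite muln_gt0 expn_gt0 andbT -ltnS prednK// (leq_trans _ hk).
have [C Cb Cc] := unit_cube_body R d.
split; last split.
- move=> n x nx; split; first exact: k_antipodal_diametral.
  by move=> [K [Kb]]; exact: diametral_k_antipodal.
- split.
  + split=> [|n [_ [x]]]; last exact: k_antipodal_bound (ltnW hk).
    split=> //; have [x xk] := cube_configuration d1 hk Cb Cc.
    by exists x; exact: diametral_k_antipodal Cb xk.
  + by move=> K; exact: fk_exists.
  + split; first by exists C; split=> //; exact: fk_cube.
    by move=> m [K [Kb [[_ [x /(fk_bound hk Kb)]]]]].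
- move=> K Kb; split; last by move=> _ x /(extremal_diametral hk Kb)[].
  split; last exact: fk_cube.
  by move=> [[_ [x /(extremal_diametral hk Kb)[]]]].
Qed.
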